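(* Let $\Omega=\{-1,1\}^{\mathbb{N}}$, let $(a_n)_{n\in\mathbb{N}}$ be a sequence of real numbers converging exponentially fast to zero, and let $g:\Omega\to\mathbb{R}$ be the Hölder potential $g(x)=\sum_{n=1}^{\infty}a_nx_n$. If $g$ is not zero, then, given $\beta>0$ and $f=-\log 2$ (constant function), the quadratic mean-field Gibbs probability $\mathfrak{m}=\mathfrak{m}_{\beta,f,g}$, that is, the weak$^*$ limit $$\mathfrak{m}(\psi)=\lim_{n\to\infty}\frac{\int\psi(x)\,e^{\frac{\beta n}{2}g_n(x)^2}\,\mu(\mathrm{d}x)}{\int e^{\frac{\beta n}{2}g_n(x)^2}\,\mu(\mathrm{d}x)},\qquad \psi\in C(\Omega),$$ satisfies $$\mathfrak{m}=\frac{\mu(h_{f+\beta t_1g})\,\nu_{f+\beta t_1g}+\mu(h_{f+\beta t_2g})\,\nu_{f+\beta t_2g}}{\mu(h_{f+\beta t_1g})+\mu(h_{f+\beta t_2g})},$$ where $t_1,t_2$ are the two self-consistent parameters, $\mu$ is the maximal entropy probability, and $h_{f+\beta t_jg}$, $\nu_{f+\beta t_jg}$, $j=1,2$, are respectively the main eigenfunction and the eigenprobability for the Ruelle operator $\mathcal{L}_{f+\beta t_jg}$.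
   Context: $T:\Omega\to\Omega$ is the shift $T(x_1,x_2,\ldots)=(x_2,x_3,\ldots)$; $\Omega$ carries the metric $d(x,y)=2^{-\min\{n:\,x_n\neq y_n\}}$ (''Hölder'' refers to this metric). The Birkhoff averages are $g_n=\frac1n(g+g\circ T+\cdots+g\circ T^{n-1})$. The maximal entropy probability $\mu$ is the product measure on $\{-1,1\}^{\mathbb{N}}$ with uniform marginals; it is the linear equilibrium probability $\mu_f$ for $f=-\log 2$. For a Hölder potential $B:\Omega\to\mathbb{R}$: the linear equilibrium probability $\mu_B$ is the unique $T$-invariant Borel probability maximizing $\rho\mapsto\rho(B)+h(\rho)$, where $h(\rho)$ is the Kolmogorov-Sinai entropy; the Ruelle operator is $\mathcal{L}_B(\psi)(x)=\sum_{a\in\{-1,1\}}e^{B(ax)}\psi(ax)$ with $ax=(a,x_1,x_2,\ldots)$; $\lambda_B>0$ is its main eigenvalue (equal to its spectral radius on $C(\Omega)$); $\nu_B$ is the eigenprobability, i.e. the probability with $\mathcal{L}_B^*\nu_B=\lambda_B\nu_B$; $h_B$ is the strictly positive Hölder main eigenfunction, $\mathcal{L}_Bh_B=\lambda_Bh_B$, normalized by $\nu_B(h_B)=1$. A self-consistent parameter is a real $t$ satisfying the self-consistency equation $t=\int g(x)\,\mu_{f+\beta tg}(\mathrm{d}x)$; the two self-consistent parameters meant are the points $t_1=t_0\neq 0$ and $t_2=-t_0$ satisfying this equation. For a measure $\rho$ and a function $\varphi$, $\rho(\varphi)=\int\varphi\,\mathrm{d}\rho$.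
   Formalization: The existence of the two self-consistent parameters t_1=t_0≠0 and t_2=-t_0 is assumed rather than claimed for every β>0: they exist only when β(∑a_n)²>1 (for example not for β=1, g(x)=x_1/2), so the formula is stated whenever they exist. *)

(* Defs.v *)
From HB Require Import structures.
From mathcomp Require Import all_boot all_order all_algebra.
From mathcomp Require Import all_classical all_reals all_analysis.

Set Implicit Arguments.
Unset Strict Implicit.
Unset Printing Implicit Defensive.

Import Order.TTheory GRing.Theory Num.Theory.
Import numFieldNormedType.Exports.

Local Open Scope classical_set_scope.
Local Open Scope ring_scope.

(* Omega = {-1,1}^N. The alphabet {-1,1} is encoded by bool through [spin]
   (true is 1, false is -1), and coordinates are indexed from 0: the coordinate
   x_n with n >= 1 of the literature is [spin (x n.-1)]. *)
Definition Omega : Type := cantor_space.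

HB.instance Definition _ := Pointed.on Omega.
HB.instance Definition _ := Nbhs.on Omega.
HB.instance Definition _ := Topological.on Omega.
HB.instance Definition _ := Uniform.on Omega.

Definition borel_Omega := g_sigma_algebraType (@open cantor_space).
HB.instance Definition _ := Measurable.copy Omega borel_Omega.

Definition spin {R : realType} (b : bool) : R := if b then 1 else - 1.

Definition Omega_shift (x : Omega) : Omega := fun n => x n.+1.

Definition prepend (b : bool) (x : Omega) : Omega :=
  fun n => if n is m.+1 then x m else b.

(* d(x,y) = 2^(-min{n >= 1 : x_n <> y_n}); the successor accounts for the
   indexing from 0. *)
Definition Omega_dist {R : realType} (x y : Omega) : R :=
  match pselect (exists n, x n != y n) with
  | left e => 2^-1 ^+ (ex_minn e).+1
  | right _ => 0
  end.

Definition hoelder_function {R : realType} (B : Omega -> R) : Prop :=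
  exists C alpha : R, 0 < alpha <= 1 /\
    forall x y, `|B x - B y| <= C * Omega_dist x y `^ alpha.

Definition exponentially_to_zero {R : realType} (a : nat -> R) : Prop :=
  exists C r : R, 0 < r < 1 /\ forall n, `|a n| <= C * r ^+ n.

(* [a n] stands for a_(n+1). *)
Definition linear_potential {R : realType} (a : nat -> R) : Omega -> R :=
  fun x => limn (fun N => \sum_(0 <= n < N) a n * spin (x n)).

Definition birkhoff {R : realType} (g : Omega -> R) (n : nat) : Omega -> R :=
  fun x => (\sum_(i < n) g (iter i Omega_shift x)) / n%:R.

(* The uniform product measure, through its values on the cylinders
   {x_1 = w_1, ..., x_n = w_n}. *)
Definition maximal_entropy_probability {R : realType}
    (mu : probability Omega R) : Prop :=
  forall (n : nat) (w : Omega),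
    mu [set x | forall i, (i < n)%N -> x i = w i] = (2^-1 ^+ n)%:E.

Definition shift_invariant {R : realType} (rho : probability Omega R) : Prop :=
  forall A : set Omega, measurable A -> rho (Omega_shift @^-1` A) = rho A.

(* A finite measurable partition is given by its labelling map. *)
Definition finite_partition (k : nat) (P : Omega -> 'I_k) : Prop :=
  forall j, measurable (P @^-1` [set j]).

(* H_rho of the join of P, T^-1 P, ..., T^-(n-1) P, whose (possibly empty)
   atoms are indexed by the words of length n; note that 0 * ln 0 = 0. *)
Definition partition_entropy {R : realType} (rho : probability Omega R)
    (k : nat) (P : Omega -> 'I_k) (n : nat) : R :=
  \sum_(w : {ffun 'I_n -> 'I_k})
    let p :=
      fine (rho [set x | forall i : 'I_n, P (iter i Omega_shift x) = w i]) in
    - (p * ln p).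

Definition KS_entropy {R : realType} (rho : probability Omega R) : \bar R :=
  ereal_sup [set e | exists (k : nat) (P : Omega -> 'I_k),
    finite_partition P /\
    e = (limn (fun n => partition_entropy rho P n / n%:R))%:E].

Definition pressure {R : realType} (B : Omega -> R)
    (rho : probability Omega R) : \bar R :=
  ((\int[rho]_x B x)%:E + KS_entropy rho)%E.

Definition linear_equilibrium {R : realType} (B : Omega -> R)
    (rho : probability Omega R) : Prop :=
  shift_invariant rho /\
  forall rho' : probability Omega R, shift_invariant rho' ->
    (pressure B rho' <= pressure B rho)%E.

Definition tilted_potential {R : realType} (f g : Omega -> R) (beta t : R) :
    Omega -> R :=
  fun x => f x + beta * t * g x.

Definition self_consistent {R : realType} (f g : Omega -> R) (beta t : R) :
    Prop :=
  exists rho : probability Omega R,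
    linear_equilibrium (tilted_potential f g beta t) rho /\
    t = \int[rho]_x g x.

Definition ruelle {R : realType} (B psi : Omega -> R) : Omega -> R :=
  fun x => \sum_(b : bool) expR (B (prepend b x)) * psi (prepend b x).

(* The main eigenvalue, main eigenfunction and eigenprobability of L_B. The
   equation for the dual operator is tested on C(Omega). The positivity of h
   forces lambda to be the spectral radius of L_B. *)
Record ruelle_eigendata {R : realType} (B : Omega -> R)
    (lambda : R) (h : Omega -> R) (nu : probability Omega R) : Prop := {
  eigenvalue_gt0 : 0 < lambda;
  eigenprobability : forall psi : Omega -> R, continuous psi ->
    \int[nu]_x ruelle B psi x = lambda * \int[nu]_x psi x;
  eigenfunction_hoelder : hoelder_function h;
  eigenfunction_gt0 : forall x, 0 < h x;
  eigenfunction : forall x, ruelle B h x = lambda * h x;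
  eigenfunction_normalized : \int[nu]_x h x = 1
}.

(* [mu] is the linear equilibrium probability of the potential f. *)
Definition quadratic_mean_field_gibbs {R : realType}
    (mu : probability Omega R) (beta : R) (g : Omega -> R)
    (m : probability Omega R) : Prop :=
  let weight n x := expR (beta * n%:R / 2 * birkhoff g n x ^+ 2) in
  forall psi : Omega -> R, continuous psi ->
    (fun n : nat => (\int[mu]_x (psi x * weight n x)) /
                    (\int[mu]_x weight n x)) @ \oo --> \int[m]_x psi x.

(* Main.v *)
From HB Require Import structures.
Require Import Defs.
From mathcomp Require Import all_boot all_order all_algebra.
From mathcomp Require Import all_classical all_reals all_analysis.
From mathcomp Require Import measurable_realfun.
From mathcomp Require Import ring lra.

(** Let [A] be the sum of the coefficients [a n] and let [u] be the linear
    potential whose coefficients are the tails of that sum. Then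
    [g x = A x_0 + u (T x) - u x] ([linear_potential_cohomology]), so the
    Birkhoff sums of [g] are [A] times those of the first spin, up to the bounded
    term [u (T^n x) - u x], and everything reduces to the Curie-Weiss model.

    Eigendata. Put [y = beta t A]. By the cohomology equation
    [exp (beta t u)] is an eigenfunction of the Ruelle operator, with eigenvalue
    [cosh y], and what remains is the transfer operator of the Bernoulli measure
    with weights [exp (+-y) / (2 cosh y)]. Hence any main eigenfunction [h] is a
    multiple of [exp (beta t u)] ([eigenfunctionE]) and [h nu] is that Bernoulli
    measure ([eigenprobability_cyl]).

    Self-consistency. For every invariant [rho] of mean spin [m] and every [y'],
    the entropy of [rho] is at most [ln (2 cosh y') - y' m] ([KS_entropy_le]):
    this is Gibbs' inequality against a Bernoulli measure, once an arbitrary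
    finite partition has been approximated by cylinders. The Bernoulli measure
    [h nu] attains the bound at [y' = y], so an equilibrium probability makes
    [y' |-> ln (2 cosh y') - y' m] minimal at [y], whence [m = tanh y] and
    [t = A tanh (beta t A)] ([self_consistent_tanh]). In particular [A <> 0], and
    [t / A] is a fixed point of [v |-> tanh (b v)] where [b = beta A^2].

    Limit. On a cylinder of length [k], let [v] be the contribution of the
    coordinates [k, ..., n - 1] to the magnetization, divided by [n]. Expanding the
    square, [(beta / 2 n) (S_n g)^2] equals
    [n b v^2 / 2 + beta A v (A x_0 + ... + A x_(k-1) + u (T^n x) - u x)] up to
    [O(1/n)]. Under the weight [exp (n b v^2 / 2)] the density [v] concentrates at
    the two maximizers [t / A] and [- t / A] of [cosh (b v) exp (- b v^2 / 2)], with
    equal masses by the spin flip ([curie_weiss_limit]). Averaging the exponential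
    of the second term at these two values gives, up to the oscillation of [u] on
    cylinders of length [k] and a constant common to all of them, the mass that
    [mu (h_1) nu_1 + mu (h_2) nu_2] gives to the cylinder ([eigendata_factor]).
    Letting [k] grow yields the limit on every cylinder, and cylinders determine
    both the weak limit and the measure. *)

Set Implicit Arguments.
Unset Strict Implicit.
Unset Printing Implicit Defensive.

Import Order.TTheory GRing.Theory Num.Theory.
Import numFieldNormedType.Exports.

Local Open Scope classical_set_scope.
Local Open Scope ring_scope.

(** * Cylinders of the shift space *)

Definition agree (k : nat) (x y : Omega) : Prop :=
  forall i, (i < k)%N -> x i = y i.

Lemma agree_le k l x y : (k <= l)%N -> agree l x y -> agree k x y.
Proof. by move=> kl H i ik; apply: H; exact: leq_trans kl. Qed.

Lemma agree_sym k x y : agree k x y -> agree k y x.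
Proof. by move=> H i ik; rewrite H. Qed.

Lemma agree_trans k x y z : agree k x y -> agree k y z -> agree k x z.
Proof. by move=> H1 H2 i ik; rewrite H1 ?H2. Qed.

Lemma agree_shift k x y :
  agree k.+1 x y -> agree k (Omega_shift x) (Omega_shift y).
Proof. by move=> H i ik; apply: H. Qed.

Lemma nbhs_agree k (x : Omega) : nbhs x [set y | agree k x y].
Proof.
have FF : Filter (nbhs x) := nbhs_filter x.
elim: k => [|k IH]; first by apply: (@filterE _ _ FF) => y i.
have /= Pk : nbhs x (@proj nat (fun=> bool) k @^-1` [set x k]).
  have /(_ [set x k]) := @proj_continuous nat (fun=> bool) k x; apply.
  by apply: open_nbhs_nbhs; split => //; exact: discrete_open.
apply: (filterS _ (filterI IH Pk)) => y [yk yxk] i.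
by rewrite ltnS leq_eqVlt => /orP[/eqP ->|]; [exact/esym/yxk|exact: yk].
Qed.

(** The cylinders around a point form a filter that converges to it
    coordinatewise, hence in the product topology. *)
Lemma agree_nbhs (x : Omega) (U : set Omega) :
  nbhs x U -> exists k, [set y | agree k x y] `<=` U.
Proof.
pose F : set_system Omega := filter_from [set: nat] (fun k => [set y | agree k x y]).
have FF : Filter F.
  apply: filter_from_filter; first by exists 0%N.
  move=> i j _ _; exists (maxn i j) => //= y yij; split;
  by apply: agree_le yij; rewrite ?leq_maxl ?leq_maxr.
suff /(_ U) : F --> (x : cantor_space).
  by move=> H /H [k _ kU]; exists k.
apply/cvg_sup => i; apply/cvg_image.
  by rewrite eqEsubset; split => // b _; exists (fun=> b).
move=> V Vxi; exists ((@^~ i) @^-1` V).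
  exists i.+1 => // y /(_ i (leqnn _)) /= <-; exact: nbhs_singleton.
rewrite eqEsubset; split => b; first by case=> y /= ? <-.
by move=> Vb; exists (fun=> b).
Qed.

Lemma open_agree k (x : Omega) : open [set y | agree k x y].
Proof.
rewrite openE => y xy; apply: filterS (nbhs_agree k y) => z /=.
exact: agree_trans.
Qed.

Lemma continuous_shift : continuous Omega_shift.
Proof.
move=> x U /agree_nbhs[k kU]; apply: filterS (nbhs_agree k.+1 x) => y xy.
by apply: kU; exact: agree_shift.
Qed.

Lemma measurable_open (U : set Omega) : open U -> measurable U.
Proof. by move=> oU; apply: sub_sigma_algebra. Qed.

Lemma measurable_shift : measurable_fun [set: Omega] Omega_shift.
Proof.
have := @measurability _ _ Omega Omega setT Omega_shift (@open cantor_space) (erefl _).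
apply => //.
move=> _ [U oU <-]; rewrite setTI; apply: measurable_open.
by have := @open_comp Omega Omega Omega_shift U; apply => // x _; exact: continuous_shift.
Qed.

(** Recursion on the word follows [Omega_shift] and [prepend], so that the Ruelle
    operator acts on indicators of cylinders by computation. *)
Fixpoint is_prefix (s : seq bool) (x : Omega) : bool :=
  if s is b :: s' then (x 0%N == b) && is_prefix s' (Omega_shift x) else true.

Definition concat (s : seq bool) (x : Omega) : Omega := foldr prepend x s.

Lemma is_prefix_concat s x : is_prefix s (concat s x).
Proof.
by elim: s => //= b s IH; rewrite eqxx.
Qed.

Lemma is_prefixP s x z :
  reflect (agree (size s) x (concat s z)) (is_prefix s x).
Proof.
elim: s x => [|b s IH] x /=; first by apply: ReflectT => i.
apply: (iffP andP) => [[/eqP xb /IH sx]|H].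
  by case => [|i] //= /sx.
split; first by apply/eqP/(H 0%N).
by apply/IH => i il; exact: (H i.+1).
Qed.

Definition cyl (s : seq bool) : set Omega := [set x | is_prefix s x].

Lemma cylE s z : cyl s = [set x | agree (size s) x (concat s z)].
Proof. by apply/seteqP; split => x /= /is_prefixP. Qed.

Lemma measurable_cyl s : measurable (cyl s).
Proof.
apply: measurable_open; rewrite (cylE s (fun=> true)).
rewrite (_ : [set _ | _] = [set x | agree (size s) (concat s (fun=> true)) x]).
  exact: open_agree.
by apply/seteqP; split => x /= /agree_sym.
Qed.

Lemma agree_prefix s x y : agree (size s) x y -> is_prefix s x = is_prefix s y.
Proof.
move=> xy; apply/(is_prefixP s x x)/(is_prefixP s y x) => H.
  by apply: agree_trans H; exact: agree_sym.
by apply: agree_trans H.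
Qed.

Lemma agree_concat s x y : agree (size s) (concat s x) (concat s y).
Proof. by apply/(is_prefixP s _ y); exact: is_prefix_concat. Qed.

Lemma is_prefix_cat s w x :
  is_prefix (s ++ w) x = is_prefix s x && is_prefix w (iter (size s) Omega_shift x).
Proof.
elim: s x => //= b s IH x; rewrite IH andbA.
by rewrite -iterSr.
Qed.

Lemma iter_shiftE n x i : iter n Omega_shift x i = x (n + i)%N.
Proof.
elim: n i => [|n IH] i //=.
by rewrite /Omega_shift IH addSnnS.
Qed.

(** Lists rather than finite functions: sums over words then split along the
    first letter. *)
Fixpoint words (n : nat) : seq (seq bool) :=
  if n is m.+1 then map (cons true) (words m) ++ map (cons false) (words m)
  else [:: [::]].

Lemma size_words n s : s \in words n -> size s = n.
Proof.
elim: n s => [|n IH] s /=; first by rewrite inE => /eqP->.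
by rewrite mem_cat => /orP[] /mapP[w /IH <- ->].
Qed.

Lemma sum_words0 (V : nmodType) (F : seq bool -> V) :
  \sum_(s <- words 0) F s = F [::].
Proof. by rewrite big_seq1. Qed.

Lemma sum_wordsS (V : nmodType) n (F : seq bool -> V) :
  \sum_(s <- words n.+1) F s =
  \sum_(s <- words n) F (true :: s) + \sum_(s <- words n) F (false :: s).
Proof. by rewrite /= big_cat !big_map. Qed.

Definition prefix_of (x : Omega) n := mkseq x n.

(** The cylinders of a given length partition the space. *)
Lemma sum_prefix (R : nzRingType) n x (F : seq bool -> R) :
  \sum_(s <- words n) F s * (is_prefix s x)%:R = F (prefix_of x n).
Proof.
elim: n x F => [|n IH] x F; first by rewrite sum_words0 mulr1.
rewrite sum_wordsS /=.
have E b : \sum_(s <- words n) F (b :: s) * ((x 0%N == b) && is_prefix s (Omega_shift x))%:R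
   = (x 0%N == b)%:R * F (b :: prefix_of (Omega_shift x) n).
  case: eqP => _ /=; last by rewrite mul0r big1// => s _; rewrite mulr0.
  by rewrite (IH _ (fun s => F (b :: s))) mul1r.
rewrite !E /prefix_of /mkseq /=.
rewrite -[iota 1 n]/(iota (1 + 0) n) iotaDl -map_comp.
by case: (x 0%N); rewrite /= ?(mul1r, mul0r, addr0, add0r).
Qed.

Lemma prefix_concat x n :
  size (prefix_of x n) = n /\ agree n x (concat (prefix_of x n) (fun=> true)).
Proof.
have sz := size_mkseq x n; split => //.
have := @is_prefixP (prefix_of x n) x (fun=> true); rewrite sz => H; apply/H.
elim: n x {H sz} => //= n IH x; rewrite eqxx /=.
have := IH (Omega_shift x); rewrite /prefix_of /mkseq.
by rewrite -[iota 1 n]/(iota (1 + 0) n) iotaDl -map_comp.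
Qed.

Section unif.
Context {R : realType}.
Implicit Types f g : Omega -> R.

(** Uniform continuity, with cylinders in the role of balls. *)
Definition cyl_uniform f : Prop :=
  forall e, 0 < e -> exists k, forall x y, agree k x y -> `|f x - f y| <= e.

(** Compactness makes the length of the cylinder uniform in the point. *)
Lemma continuous_cyl_uniform f : continuous f -> cyl_uniform f.
Proof.
move=> cf e e0.
have /compact_near_coveringP/(_ nat \oo
    (fun k x => forall y, agree k x y -> `|f x - f y| <= e)) :=
  cantor_space_compact.
case.
  move=> x _.
  have /agree_nbhs[k kU] : nbhs x (f @^-1` (ball (f x) (e / 2))).
    by apply: cf; apply: nbhsx_ballx; rewrite divr_gt0.
  exists ([set y | agree k x y], [set l | (k <= l)%N]) => /=.
    by split; [exact: nbhs_agree | exists k].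
  case=> y l [/= xy kl] z yz.
  have H1 := kU _ xy; have H2 := kU _ (agree_trans xy (agree_le kl yz)).
  move: H1 H2; rewrite /ball /= => H1 H2.
  rewrite -(subrKA (f x)) (le_trans (ler_normD _ _))// [e]splitr lerD// ltW//.
  by rewrite distrC.
move=> k _ /(_ k (leqnn k)) H; exists k => x y xy.
by apply: H.
Qed.

Lemma cyl_uniform_continuous f : cyl_uniform f -> continuous f.
Proof.
move=> uf x; apply/cvgrPdist_le => e e0.
have [k H] := uf e e0.
by apply: filterS (nbhs_agree k x) => y /H.
Qed.

Lemma cyl_uniform_measurable f : cyl_uniform f -> measurable_fun [set: Omega] f.
Proof.
move=> /cyl_uniform_continuous cf.
apply: (measurability _ (measurable_realfun.RGenOpens.measurableE R)) => //.
move=> _ [_ [a [b ->]] <-]; rewrite setTI; apply: measurable_open.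
have := @open_comp Omega R f `]a, b[; apply; last exact: interval_open.
by move=> x _; exact: cf.
Qed.

Lemma cyl_uniform_bounded f : cyl_uniform f -> exists M, forall x, `|f x| <= M.
Proof.
move=> /(_ 1 ltr01)[k H].
exists (\sum_(s <- words k) `|f (concat s (fun=> true))| + 1) => x.
have [sz ag] := prefix_concat x k.
rewrite -[f x](subrK (f (concat (prefix_of x k) (fun=> true)))) addrC.
rewrite (le_trans (ler_normD _ _))// lerD//; last exact: H.
rewrite -(sum_prefix k x (fun s => `|f (concat s (fun=> true))|)) ler_sum// => s _.
by rewrite ler_piMr// lern1 leq_b1.
Qed.

End unif.

(** * Bounded measurable functions and measures on cylinders *)

Lemma mem_boolE T (p : T -> bool) x : (x \in [set x | p x]) = p x.
Proof. by apply/idP/idP => H; [move: H => /set_mem | rewrite mem_set]. Qed.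

Section bounded_measurable.
Context d (T : measurableType d) {R : realType}.
Implicit Types (f g : T -> R) (P : probability T R).

Definition bmeas f : Prop :=
  measurable_fun [set: T] f /\ exists M, forall x, `|f x| <= M.

Lemma bmeas_cst c : bmeas (fun=> c).
Proof. by split; [exact: measurable_cst | exists `|c|]. Qed.

Lemma bmeasD f g : bmeas f -> bmeas g -> bmeas (fun x => f x + g x).
Proof.
move=> [mf [M Mf]] [mg [N Ng]]; split; first exact: measurable_funD.
by exists (M + N) => x; rewrite (le_trans (ler_normD _ _))// lerD.
Qed.

Lemma bmeasM f g : bmeas f -> bmeas g -> bmeas (fun x => f x * g x).
Proof.
move=> [mf [M Mf]] [mg [N Ng]]; split; first exact: measurable_funM.
by exists (M * N) => x; rewrite normrM ler_pM.
Qed.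

Lemma bmeasZ c f : bmeas f -> bmeas (fun x => c * f x).
Proof. by apply: bmeasM; exact: bmeas_cst. Qed.

Lemma bmeasN f : bmeas f -> bmeas (fun x => - f x).
Proof.
move=> /(bmeasZ (-1)); congr bmeas.
by apply/funext => x; rewrite mulN1r.
Qed.

Lemma bmeasB f g : bmeas f -> bmeas g -> bmeas (fun x => f x - g x).
Proof. by move=> bf bg; apply: bmeasD => //; exact: bmeasN. Qed.

Lemma bmeas_sum I (s : seq I) (h : I -> T -> R) :
  (forall i, bmeas (h i)) -> bmeas (fun x => \sum_(i <- s) h i x).
Proof.
move=> bh; split; first by apply: measurable_sum => i; exact: (bh i).1.
elim: s => [|i s [M IH]]; first by exists 0 => x; rewrite big_nil normr0.
have [N Hi] := (bh i).2.
exists (N + M) => x; rewrite big_cons (le_trans (ler_normD _ _))//.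
by rewrite lerD.
Qed.

Lemma bmeas_expR f : bmeas f -> bmeas (fun x => expR (f x)).
Proof.
move=> [mf [M Mf]]; split; first exact: measurableT_comp.
exists (expR M) => x; rewrite ger0_norm ?expR_ge0// ler_expR.
exact: le_trans (ler_norm _) (Mf x).
Qed.

Lemma bmeas_bool (p : T -> bool) :
  measurable [set x | p x] -> bmeas (fun x => (p x)%:R).
Proof.
move=> mp; split; last by exists 1 => x; rewrite normr_nat lern1 leq_b1.
rewrite (_ : (fun _ => _) = \1_[set x | p x]); first exact: measurable_indic.
by apply/funext => x; rewrite indicE mem_boolE.
Qed.

Lemma bmeas_integrable P f : bmeas f -> P.-integrable [set: T] (EFin \o f).
Proof.
move=> [mf [M Mf]]; apply: measurable_bounded_integrable => //.
  by have /= -> := probability_setT P; rewrite ltry.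
exists M; split; first exact: num_real.
by move=> x Mx y _; exact: le_trans (Mf y) (ltW Mx).
Qed.

Lemma E_cst P c : \int[P]_x (fun _ => c) x = c.
Proof. by rewrite Rintegral_cst//= probability_setT mulr1. Qed.

Lemma E_D P f g : bmeas f -> bmeas g ->
  \int[P]_x (f x + g x) = \int[P]_x f x + \int[P]_x g x.
Proof. by move=> bf bg; rewrite RintegralD//; exact: bmeas_integrable. Qed.

Lemma E_Z P c f : bmeas f -> \int[P]_x (c * f x) = c * \int[P]_x f x.
Proof. by move=> bf; rewrite RintegralZl//; exact: bmeas_integrable. Qed.

Lemma E_B P f g : bmeas f -> bmeas g ->
  \int[P]_x (f x - g x) = \int[P]_x f x - \int[P]_x g x.
Proof. by move=> bf bg; rewrite RintegralB//; exact: bmeas_integrable. Qed.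

Lemma E_sum P I (s : seq I) (h : I -> T -> R) : (forall i, bmeas (h i)) ->
  \int[P]_x (\sum_(i <- s) h i x) = \sum_(i <- s) \int[P]_x h i x.
Proof.
move=> bh; elim: s => [|i s IH].
  rewrite big_nil -[RHS](E_cst P 0); apply: eq_Rintegral => x _.
  by rewrite big_nil.
rewrite big_cons -IH -E_D//; last exact: bmeas_sum.
by apply: eq_Rintegral => x _; rewrite big_cons.
Qed.

Lemma E_le P f g : bmeas f -> bmeas g -> (forall x, f x <= g x) ->
  \int[P]_x f x <= \int[P]_x g x.
Proof. by move=> bf bg fg; apply: le_Rintegral => //; exact: bmeas_integrable. Qed.

Lemma E_bool P (p : T -> bool) : measurable [set x | p x] ->
  \int[P]_x (p x)%:R = fine (P [set x | p x]).
Proof.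
move=> mp; rewrite /Rintegral -[in RHS](setIT [set x | p x]) -integral_indic//.
congr fine; apply: eq_integral => x _; by rewrite indicE mem_boolE.
Qed.

Lemma E_dist P f g e : bmeas f -> bmeas g -> (forall x, `|f x - g x| <= e) ->
  `|\int[P]_x f x - \int[P]_x g x| <= e.
Proof.
move=> bf bg fg; rewrite ler_norml -E_B//.
rewrite -[X in _ <= _ <= X](E_cst P e) -[X in X <= _](E_cst P (- e)).
by apply/andP; split; apply: E_le; try exact: bmeas_cst; try exact: bmeasB;
  move=> x; move: (fg x); rewrite ler_norml => /andP[].
Qed.

Lemma E_gt0 P f : bmeas f -> (exists2 c, 0 < c & forall x, c <= f x) ->
  0 < \int[P]_x f x.
Proof.
move=> bf [c c0 cf]; apply: (lt_le_trans c0).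
by rewrite -[X in X <= _](E_cst P c); apply: E_le => //; exact: bmeas_cst.
Qed.

Lemma E_exp_gt0 P f : bmeas f -> 0 < \int[P]_x expR (f x).
Proof.
move=> bf; apply: E_gt0; first exact: bmeas_expR.
case: bf => _ [M Mf]; exists (expR (- M)); first exact: expR_gt0.
by move=> x; rewrite ler_expR; move: (Mf x); rewrite ler_norml => /andP[].
Qed.

Lemma probability_fineK P A : measurable A -> (fine (P A))%:E = P A.
Proof. by move=> mA; rewrite fineK// fin_num_measure. Qed.

End bounded_measurable.

Section continuous_closure.
Context {R : realType}.
Implicit Types f g : Omega -> R.

Lemma continuous_bmeas f : continuous f -> bmeas f.
Proof.
move=> /continuous_cyl_uniform uf; split.
  exact: cyl_uniform_measurable.
exact: cyl_uniform_bounded.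
Qed.

Lemma continuous_cst (c : R) : continuous (fun _ : Omega => c).
Proof. by move=> x; exact: cvg_cst. Qed.

Lemma continuous_add f g : continuous f -> continuous g -> continuous (fun x => f x + g x).
Proof. by move=> cf cg x; apply: cvgD; [exact: cf | exact: cg]. Qed.

Lemma continuous_mul f g : continuous f -> continuous g -> continuous (fun x => f x * g x).
Proof. by move=> cf cg x; apply: cvgM; [exact: cf | exact: cg]. Qed.

Lemma continuous_exp f : continuous f -> continuous (fun x => expR (f x)).
Proof.
move=> cf x; apply: (@cvg_comp _ _ _ f expR); first exact: cf.
exact: continuous_expR.
Qed.

Lemma continuous_prefix s : continuous (fun x => (is_prefix s x)%:R : R).
Proof.
apply: cyl_uniform_continuous => e e0; exists (size s) => x y xy.
by rewrite (agree_prefix xy) subrr normr0 ltW.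
Qed.

Lemma continuous_comp_shift f : continuous f -> continuous (fun x => f (Omega_shift x)).
Proof.
move=> cf x; apply: (@cvg_comp _ _ _ Omega_shift f); last exact: cf.
exact: continuous_shift.
Qed.

Lemma continuous_comp_iter f n : continuous f -> continuous (fun x => f (iter n Omega_shift x)).
Proof.
elim: n f => // n IH f cf.
exact: (IH (fun x => f (Omega_shift x)) (continuous_comp_shift cf)).
Qed.

Lemma continuous_spin i : continuous (fun x : Omega => spin (x i) : R).
Proof.
apply: cyl_uniform_continuous => e e0; exists i.+1 => x y -> //.
by rewrite subrr normr0 ltW.
Qed.

End continuous_closure.

Lemma cyl_setI s t : (size s <= size t)%N ->
  cyl s `&` cyl t = set0 \/ cyl s `&` cyl t = cyl t.
Proof.
move=> st; case: (pselect (cyl s `&` cyl t = set0)) => [|/eqP/set0P[x [xs xt]]]; [by left|right].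
apply/setIidr => y yt.
have xt' := elimT (is_prefixP t x y) xt; have yt' := elimT (is_prefixP t y y) yt.
suff : is_prefix s y = is_prefix s x by rewrite /cyl /= => ->.
apply: agree_prefix; apply: (agree_le st).
by apply: (agree_trans yt'); exact: agree_sym.
Qed.

(** An open set is the union of the countably many cylinders that it contains. *)
Lemma measurable_cylinders :
  @measurable _ Omega = <<s [set A | A = set0 \/ exists s, A = cyl s] >>.
Proof.
set G := [set A | _]; apply/seteqP; split; last first.
  apply: smallest_sub; first exact: sigma_algebra_measurable.
  by move=> A [->|[s ->]]; [exact: measurable0 | exact: measurable_cyl].
apply: smallest_sub; first exact: smallest_sigma_algebra.
move=> U oU.
have GF s : G (if `[< cyl s `<=` U >] then cyl s else set0).
  by case: asboolP => _; [right; exists s | left].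
have -> : U = \bigcup_s (if `[< cyl s `<=` U >] then cyl s else set0).
  apply/seteqP; split => x; last by case=> s _; case: asboolP => // sU; exact: sU.
  move=> Ux; have /agree_nbhs[k kU] : nbhs x U by apply: open_nbhs_nbhs.
  have [sz ag] := prefix_concat x k.
  have cE := cylE (prefix_of x k) (fun=> true); rewrite sz in cE.
  have xc : cyl (prefix_of x k) x by rewrite cE.
  have sU : cyl (prefix_of x k) `<=` U.
    move=> y; rewrite cE /= => yk.
    by apply: kU; apply: (agree_trans ag); exact: agree_sym.
  by exists (prefix_of x k) => //; case: asboolP.
apply: (@countable_bigcupT_measurable _ (g_sigma_algebraType G)) => // s.
apply: sub_gen_smallest; exact: GF.
Qed.

(** Together with the empty set the cylinders form a pi-system. *)
Lemma measure_cyl_unique (R : realType) (m1 m2 : {measure set Omega -> \bar R}) :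
  (m1 [set: Omega] < +oo)%E -> (forall s, m1 (cyl s) = m2 (cyl s)) ->
  forall A, measurable A -> m1 A = m2 A.
Proof.
move=> fin12 H; apply: (measure_unique _ (fun=> cyl [::]) measurable_cylinders).
- move=> A B /= [->|[s ->]]; first by left; rewrite set0I.
  move=> [->|[t ->]]; first by left; rewrite setI0.
  have [st|/ltnW ts] := leqP (size s) (size t).
    by case: (cyl_setI st) => ->; [left|right; exists t].
  by rewrite setIC; case: (cyl_setI ts) => ->; [left|right; exists s].
- by right; exists [::].
- by apply/seteqP; split => // x _; exists 0%N.
- by move=> A [->|[s ->]] //; rewrite !measure0.
- by move=> _; rewrite (_ : cyl [::] = setT)//; apply/seteqP; split.
Qed.

Lemma agree_cylE n w : [set x | agree n x w] = cyl (prefix_of w n).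
Proof.
have [sz ag] := prefix_concat w n.
rewrite (cylE _ (fun=> true)) sz; apply/seteqP; split => x /= H.
  exact: agree_trans ag.
by apply: (agree_trans H); exact: agree_sym.
Qed.

Section cylinder_approximation.
Context {R : realType}.
Implicit Types f g : Omega -> R.

(** On each cylinder of length [k] the value of [f] is read at the point of the
    cylinder that continues with [true] forever. *)
Definition cyl_approx k f : Omega -> R := fun x =>
  \sum_(s <- words k) f (concat s (fun=> true)) * (is_prefix s x)%:R.

Lemma bmeas_prefix s : bmeas (fun x => (is_prefix s x)%:R : R).
Proof. by apply: continuous_bmeas; exact: continuous_prefix. Qed.

Lemma cyl_approxP f e : continuous f -> 0 < e ->
  exists k, forall x, `|f x - cyl_approx k f x| <= e.
Proof.
move=> cf e0; have [k H] := continuous_cyl_uniform cf e0; exists k => x.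
rewrite /cyl_approx (sum_prefix k x (fun s => f (concat s (fun=> true)))).
by apply: H; exact: (prefix_concat x k).2.
Qed.

Lemma bmeas_cyl_approx k f : bmeas (cyl_approx k f).
Proof. by apply: bmeas_sum => s; apply: bmeasZ; exact: bmeas_prefix. Qed.

Lemma E_cyl_approx (P : probability Omega R) k f :
  \int[P]_x cyl_approx k f x =
  \sum_(s <- words k) f (concat s (fun=> true)) * fine (P (cyl s)).
Proof.
rewrite E_sum; last by move=> s; apply: bmeasZ; exact: bmeas_prefix.
apply: eq_bigr => s _; rewrite E_Z ?E_bool//; last exact: bmeas_prefix.
exact: measurable_cyl.
Qed.

Lemma E_prefix (P : probability Omega R) s :
  \int[P]_x (is_prefix s x)%:R = fine (P (cyl s)).
Proof. by rewrite E_bool//; exact: measurable_cyl. Qed.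

End cylinder_approximation.

(** * Linear potentials are cohomologous to a multiple of the first spin *)

Section linear_potential.
Context {R : realType}.
Implicit Types a b : nat -> R.

Lemma geometric_series_bound b (C r : R) : 0 < r < 1 ->
  (forall n, `|b n| <= C * r ^+ n) ->
  cvgn (series b) /\ `|limn (series b)| <= C / (1 - r).
Proof.
move=> /andP[r0 r1] bC.
have C0 : 0 <= C by move: (bC 0%N); rewrite expr0 mulr1; exact: le_trans.
have nr : `|r| < 1 by rewrite ger0_norm ?ltW.
have cg : cvgn (series (geometric C r)) by exact: is_cvg_geometric_series.
have le N : `|series b N| <= C / (1 - r).
  rewrite /series /= (le_trans (ler_norm_sum _ _ _))//.
  apply: (@le_trans _ _ (series (geometric C r) N)).
    by rewrite /series /=; apply: ler_sum => i _; exact: bC.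
  rewrite -(cvg_lim _ (cvg_geometric_series (a := C) nr))//.
  apply: nondecreasing_cvgn_le => //; apply: nondecreasing_series => n _ _ /=.
  by rewrite mulr_ge0// exprn_ge0// ltW.
have cn : cvgn [normed series b].
  apply: (series_le_cvg _ _ bC cg) => n //.
  by rewrite mulr_ge0// exprn_ge0// ltW.
have cb := normed_cvg cn; split => //.
rewrite -lim_norm//; apply: limr_le; first exact: is_cvg_norm.
by apply: nearW => N; exact: le.
Qed.

Lemma limn_series_recl b : cvgn (series (fun n => b n.+1)) ->
  limn (series b) = b 0%N + limn (series (fun n => b n.+1)).
Proof.
move=> cb; apply/cvg_lim => //; rewrite -cvg_shiftS.
rewrite (_ : (fun _ => _) = (fun n => b 0%N + series (fun n => b n.+1) n)).
  by apply: cvgD => //; exact: cvg_cst.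
by apply/funext => n; rewrite /series /= big_nat_recl.
Qed.

Lemma spin_norm c : `|spin c : R| = 1.
Proof. by case: c; rewrite /spin ?normrN normr1. Qed.

Section bounds.
Variables (r : R).
Hypothesis r01 : 0 < r < 1.

Lemma linear_potential_bound a C x : (forall n, `|a n| <= C * r ^+ n) ->
  cvgn (series (fun n => a n * spin (x n))) /\
  `|linear_potential a x| <= C / (1 - r).
Proof.
move=> aC; apply: (geometric_series_bound r01) => n.
by rewrite normrM spin_norm mulr1.
Qed.

Lemma shift_bound a C : (forall n, `|a n| <= C * r ^+ n) ->
  forall n, `|a n.+1| <= C * r * r ^+ n.
Proof. by move=> aC n; rewrite -mulrA -exprS. Qed.

Lemma linear_potentialS a C x : (forall n, `|a n| <= C * r ^+ n) ->
  linear_potential a x =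
  a 0%N * spin (x 0%N) + linear_potential (fun n => a n.+1) (Omega_shift x).
Proof.
move=> aC; apply: (limn_series_recl (b := fun n => a n * spin (x n))).
exact: (linear_potential_bound (Omega_shift x) (shift_bound aC)).1.
Qed.

Lemma linear_potential_modulus a C k x y : (forall n, `|a n| <= C * r ^+ n) ->
  agree k x y ->
  `|linear_potential a x - linear_potential a y| <= 2 * C / (1 - r) * r ^+ k.
Proof.
elim: k a C x y => [|k IH] a C x y aC xy.
  rewrite expr0 mulr1 (le_trans (ler_normB _ _))// -mulrA mulr_natl mulr2n.
  by rewrite lerD//; exact: (linear_potential_bound _ aC).2.
rewrite !(linear_potentialS _ aC) xy// opprD addrACA subrr add0r.
rewrite (le_trans (IH _ _ _ _ (shift_bound aC) (agree_shift xy)))//.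
by rewrite exprS; rewrite le_eqVlt; apply/predU1P; left; ring.
Qed.

End bounds.

(** [u] is the linear potential with coefficients the tails
    [a_(n+1) + a_(n+2) + ...]. Adding the coefficients of [linear_potential a]
    shifts these tails by one place and leaves their total [A] on the first spin. *)
Lemma linear_potential_cohomology a : exponentially_to_zero a ->
  exists (A : R) (u : Omega -> R), continuous u /\
    forall x, linear_potential a x = A * spin (x 0%N) + u (Omega_shift x) - u x.
Proof.
move=> [C [r [r01 aC]]]; have /andP[r0 r1] := r01.
have r1' : 0 < 1 - r by rewrite subr_gt0.
pose tl m := limn (series (fun k => a (m + k)%N)).
have bnd m k : `|a (m + k)%N| <= C * r ^+ m * r ^+ k.
  by rewrite -mulrA -exprD.
have tlS m : tl m = a m + tl m.+1.
  rewrite /tl (limn_series_recl (b := fun k => a (m + k)%N)) ?addn0.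
    congr (_ + limn (series _)); apply/funext => k; by rewrite addnS addSn.
  rewrite (_ : (fun _ => _) = (fun k => a (m.+1 + k)%N)).
    exact: (geometric_series_bound r01 (bnd m.+1)).1.
  by apply/funext => k; rewrite addnS addSn.
pose D := C * r / (1 - r).
have tlD n : `|tl n.+1| <= D * r ^+ n.
  rewrite (le_trans (geometric_series_bound r01 (bnd n.+1)).2)//.
  by rewrite /D exprS; rewrite le_eqVlt; apply/predU1P; left; ring.
exists (tl 0%N), (linear_potential (fun n => tl n.+1)); split.
  apply: cyl_uniform_continuous => e e0.
  have : (fun k => 2 * D / (1 - r) * r ^+ k) @ \oo --> 2 * D / (1 - r) * 0.
    apply: cvgM; first exact: cvg_cst.
    by apply: cvg_expr; rewrite ger0_norm ?ltW.
  rewrite mulr0 => /cvgrPdist_le/(_ e e0)[k _ /(_ k (leqnn k)) /= H].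
  exists k => x y xy; rewrite (le_trans (linear_potential_modulus r01 tlD xy))//.
  by move: H; rewrite sub0r normrN; apply: le_trans; exact: ler_norm.
move=> x; apply/eqP; rewrite -subr_eq opprK addrC eq_sym; apply/eqP.
have tl0D n : `|tl n| <= (C / (1 - r)) * r ^+ n.
  rewrite (le_trans (geometric_series_bound r01 (bnd n)).2)//.
  by rewrite le_eqVlt; apply/predU1P; left; ring.
rewrite -(linear_potentialS r01 x tl0D) /linear_potential -limD.
- congr (limn _); apply/funext => N; rewrite fctE /series /= -big_split /=.
  by apply: eq_bigr => i _; rewrite [tl i]tlS mulrDl addrC.
- exact: (linear_potential_bound r01 x tlD).1.
- exact: (linear_potential_bound r01 x aC).1.
Qed.

End linear_potential.

(** * Eigendata of the Ruelle operator *)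

Section bernoulli_weights.
Context {R : realType}.
Implicit Types y : R.

Definition cosh y : R := (expR y + expR (- y)) / 2.

Lemma cosh_gt0 y : 0 < cosh y.
Proof. by rewrite divr_gt0// addr_gt0 ?expR_gt0. Qed.

Lemma coshN y : cosh (- y) = cosh y.
Proof. by rewrite /cosh opprK addrC. Qed.

(** The weights of the Bernoulli measure of external field [y]. *)
Definition spin_weight y (b : bool) : R := expR (y * spin b) / (2 * cosh y).

Lemma spin_weight_gt0 y b : 0 < spin_weight y b.
Proof. by rewrite divr_gt0 ?expR_gt0// mulr_gt0// cosh_gt0. Qed.

Lemma spin_weight_sum y : spin_weight y true + spin_weight y false = 1.
Proof.
rewrite /spin_weight /spin mulr1 mulrN1 -mulrDl /cosh mulrC [X in X^-1]mulrC mulfVK//.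
by rewrite mulVf// gt_eqF// addr_gt0 ?expR_gt0.
Qed.

Definition word_weight y (s : seq bool) : R := \prod_(b <- s) spin_weight y b.

Lemma word_weight_cons y b s : word_weight y (b :: s) = spin_weight y b * word_weight y s.
Proof. by rewrite /word_weight big_cons. Qed.

Lemma word_weight_gt0 y s : 0 < word_weight y s.
Proof.
elim: s => [|b s IH]; first by rewrite /word_weight big_nil.
by rewrite word_weight_cons mulr_gt0 ?spin_weight_gt0.
Qed.

Lemma sum_word_weight y n : \sum_(s <- words n) word_weight y s = 1.
Proof.
elim: n => [|n IH]; first by rewrite sum_words0 /word_weight big_nil.
rewrite sum_wordsS; under eq_bigr do rewrite word_weight_cons.
under [X in _ + X]eq_bigr do rewrite word_weight_cons.
by rewrite -!mulr_sumr IH !mulr1 spin_weight_sum.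
Qed.

Definition magn (s : seq bool) : R := \sum_(b <- s) spin b.

Lemma word_weightE y s : word_weight y s = expR (y * magn s) / (2 * cosh y) ^+ size s.
Proof.
elim: s => [|b s IH]; first by rewrite /word_weight /magn !big_nil mulr0 expR0 expr0 divr1.
rewrite word_weight_cons IH /magn big_cons mulrDr expRD /= exprS invfM /spin_weight.
by ring.
Qed.

End bernoulli_weights.

Section eigendata.
Context {R : realType}.
Variables (g u : Omega -> R) (A beta t : R).
Hypothesis cu : continuous u.
Hypothesis gE : forall x, g x = A * spin (x 0%N) + u (Omega_shift x) - u x.

Let y := beta * t * A.
Let h0 x := expR (beta * t * u x).
Let B := tilted_potential (fun=> - ln 2) g beta t.

Let h0_gt0 x : 0 < h0 x. Proof. exact: expR_gt0. Qed.

Lemma continuous_exp_cohomology : continuous h0.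
Proof.
apply: continuous_exp; apply: continuous_mul => //; exact: continuous_cst.
Qed.

(** Conjugating by [exp (beta t u)] removes the coboundary from the potential:
    only the Bernoulli weight of the prepended spin is left. *)
Lemma tilted_cohomology b x :
  expR (B (prepend b x)) * h0 (prepend b x) =
  cosh y * spin_weight y b * h0 x.
Proof.
have -> : cosh y * spin_weight y b = 2^-1 * expR (y * spin b).
  by rewrite /spin_weight; field; rewrite gt_eqF// cosh_gt0.
rewrite -[2^-1](@lnK R); last by rewrite posrE invr_gt0.
rewrite -!expRD lnV ?posrE//; congr expR.
rewrite /B /tilted_potential gE /y /=.
have -> : Omega_shift (prepend b x) = x by [].
by ring.
Qed.

Variables (lambda : R) (h : Omega -> R) (nu : probability Omega R).
Hypothesis D : ruelle_eigendata B lambda h nu.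

Lemma hoelder_continuous : continuous h.
Proof.
have [C [a [/andP[a0 a1] H]]] := eigenfunction_hoelder D.
apply: cyl_uniform_continuous => e e0.
have C'0 : 0 < `|C| + 1 by rewrite ltr_wpDl.
have dk k x z : agree k x z -> Omega_dist x z <= 2^-1 ^+ k :> R.
  move=> xz; rewrite /Omega_dist; case: pselect => [ex|_]; last first.
    by rewrite exprn_ge0.
  case: ex_minnP => m xzm _.
  have km : (k <= m)%N.
    by rewrite leqNgt; apply/negP => mk; move: xzm; rewrite xz ?eqxx.
  by rewrite ler_wiXn2l ?invr_ge0 ?invf_le1 ?ler1n// leqW.
have : (fun k : nat => (2^-1 : R) ^+ k) @ \oo --> (0 : R).
  by apply: cvg_expr; rewrite ger0_norm ?invr_ge0// invf_lt1// ltr1n.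
have e1 : 0 < (e / (`|C| + 1)) `^ a^-1 by rewrite powR_gt0 ?divr_gt0.
move=> /cvgrPdist_le/(_ _ e1)[k _ /(_ k (leqnn k))/=].
rewrite sub0r normrN ger0_norm ?exprn_ge0 ?invr_ge0// => k2.
exists k => x z /dk xz; apply: (le_trans (H x z)).
have d0 : 0 <= Omega_dist x z :> R.
  by rewrite /Omega_dist; case: pselect => // *; rewrite exprn_ge0 ?invr_ge0.
apply: (@le_trans _ _ ((`|C| + 1) * (e / (`|C| + 1)))); last first.
  by rewrite mulrC divfK ?gt_eqF.
apply: (@le_trans _ _ ((`|C| + 1) * Omega_dist x z `^ a)).
  by rewrite ler_wpM2r ?powR_ge0// (le_trans (ler_norm _))// lerDl.
rewrite ler_pM2l//.
have -> : e / (`|C| + 1) = ((e / (`|C| + 1)) `^ a^-1) `^ a.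
  by rewrite -powRrM mulVf ?gt_eqF// powRr1// divr_ge0 ?ltW.
apply: ge0_ler_powR; rewrite ?nnegrE ?powR_ge0//; first exact: ltW.
exact: le_trans xz k2.
Qed.

Let continuous_h : continuous h := hoelder_continuous.

Let bmeas_c (f : Omega -> R) : continuous f -> bmeas f := @continuous_bmeas R f.

Lemma ruelle_exp_cohomology x : ruelle B h0 x = cosh y * h0 x.
Proof.
rewrite /ruelle big_bool /= !tilted_cohomology -mulrDl -mulrDr spin_weight_sum mulr1.
by [].
Qed.

(** Test the eigenprobability on the eigenfunction [exp (beta t u)], whose integral
    is positive. *)
Lemma eigenvalueE : lambda = cosh y.
Proof.
have := eigenprobability D continuous_exp_cohomology.
under eq_Rintegral do rewrite ruelle_exp_cohomology.
rewrite E_Z; last exact: bmeas_c continuous_exp_cohomology.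
have p : 0 < \int[nu]_x h0 x.
  apply: E_exp_gt0; apply: bmeas_c.
  by apply: continuous_mul => //; exact: continuous_cst.
by move/(mulIf (lt0r_neq0 p)).
Qed.

(** The quotient [k] of [h] by [exp (beta t u)] is harmonic for the Bernoulli
    weights. Iterating [n] times, [k x] and [k z] are averages of values of [k] at
    points that agree on [n] coordinates, so [k] is constant. *)
Lemma eigenfunctionE : exists2 K, 0 < K & forall x, h x = K * h0 x.
Proof.
pose k x := h x / h0 x.
have ck : continuous k.
  have -> : k = fun x => h x * expR (- (beta * t) * u x).
    by apply/funext => x; rewrite /k /h0 mulNr expRN.
  apply: continuous_mul => //; apply: continuous_exp.
  by apply: continuous_mul => //; exact: continuous_cst.
have kS x : k x = spin_weight y true * k (prepend true x) + spin_weight y false * k (prepend false x).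
  have c0 := gt_eqF (cosh_gt0 y).
  have := eigenfunction D x; rewrite eigenvalueE /ruelle big_bool /=.
  have T b : expR (B (prepend b x)) * h (prepend b x) = cosh y * h0 x * (spin_weight y b * k (prepend b x)).
    transitivity (expR (B (prepend b x)) * h0 (prepend b x) * k (prepend b x)).
      by rewrite /k -mulrA [h0 _ * _]mulrC divfK// gt_eqF.
    by rewrite tilted_cohomology; ring.
  rewrite !T -mulrDr -mulrA => /(mulfI (negbT c0)) E.
  by rewrite -[LHS]/(h x / h0 x) -E mulrAC mulfV ?mul1r// gt_eqF.
have kn n x : k x = \sum_(w <- words n) word_weight y w * k (concat w x).
  elim: n x => [|n IH] x; first by rewrite sum_words0 /word_weight big_nil mul1r.
  rewrite IH sum_wordsS -big_split; apply: eq_bigr => w _ /=.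
  by rewrite !word_weight_cons kS; ring.
have kc x z : k x = k z.
  apply/eqP; rewrite -subr_eq0 -normr_le0; apply/ler_addgt0Pl => e e0; rewrite addr0.
  have [n H] := continuous_cyl_uniform ck e0.
  rewrite (kn n x) (kn n z) -sumrB (le_trans (ler_norm_sum _ _ _))//.
  rewrite -[e]mul1r -(sum_word_weight y n) mulr_suml big_seq [X in _ <= X]big_seq.
  apply: ler_sum => w /size_words wn.
  rewrite -mulrBr normrM [`|word_weight _ _|]gtr0_norm ?word_weight_gt0// ler_pM2l ?word_weight_gt0//.
  by apply: H; rewrite -wn; exact: agree_concat.
exists (k (fun=> true)); first by rewrite divr_gt0// (eigenfunction_gt0 D).
by move=> x; rewrite (kc _ x) divfK// gt_eqF.
Qed.

(** The measure [h nu] is Bernoulli: the operator turns the indicator of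
    [b :: s] into that of [s] and produces the weight of [b]. *)
Lemma eigenprobability_cyl s : \int[nu]_x ((is_prefix s x)%:R * h x) = word_weight y s.
Proof.
have [K K0 hE] := eigenfunctionE.
elim: s => [|b s IH].
  rewrite /word_weight big_nil -[RHS](eigenfunction_normalized D).
  by apply: eq_Rintegral => x _; rewrite mul1r.
have cs r : continuous (fun x => (is_prefix r x)%:R * h x).
  by apply: continuous_mul => //; exact: continuous_prefix.
have := eigenprobability D (cs (b :: s)); rewrite eigenvalueE word_weight_cons -IH.
have E x : ruelle B (fun z => (is_prefix (b :: s) z)%:R * h z) x =
    cosh y * spin_weight y b * ((is_prefix s x)%:R * h x).
  have T c : expR (B (prepend c x)) * ((is_prefix (b :: s) (prepend c x))%:R * h (prepend c x))
     = (c == b)%:R * (cosh y * spin_weight y b * ((is_prefix s x)%:R * h x)).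
    rewrite /=; case: eqP => [->|_] /=; last by rewrite !(mul0r, mulr0).
    have -> : Omega_shift (prepend b x) = x by [].
    rewrite !hE mul1r mulrCA [expR _ * (K * _)]mulrCA tilted_cohomology.
    by ring.
  rewrite /ruelle big_bool /= !T.
  by case: b {T}; rewrite /= !(mul1r, mul0r, addr0, add0r).
under eq_Rintegral do rewrite E.
rewrite E_Z; last exact: bmeas_c (cs s).
move=> H; apply: (mulfI (negbT (gt_eqF (cosh_gt0 y)))).
by rewrite -H [RHS]mulrA.
Qed.

(** On a cylinder where [u] oscillates by at most [e], the eigenfunction is constant
    up to the factor [exp a], so [eigenprobability_cyl] gives the mass of the
    cylinder up to the same factor. *)
Lemma eigendata_cyl K s e : (forall x, h x = K * h0 x) -> 0 < K ->
  (forall x z, agree (size s) x z -> `|u x - u z| <= e) ->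
  let a := `|beta * t| * e in let z := concat s (fun=> true) in
  expR (- a) * word_weight y s <= K * h0 z * fine (nu (cyl s)) <= expR a * word_weight y s.
Proof.
move=> hE K0 H /=; set a := _ * e; set z := concat _ _.
rewrite -eigenprobability_cyl -E_prefix -!E_Z; last 3 first.
- by apply: bmeas_c; apply: continuous_mul => //; exact: continuous_prefix.
- exact: bmeas_prefix.
- by apply: bmeas_c; apply: continuous_mul => //; exact: continuous_prefix.
have close x : is_prefix s x -> `|beta * t * u x - beta * t * u z| <= a.
  move=> /(is_prefixP s x (fun=> true)) /H xz.
  by rewrite -mulrBr normrM ler_wpM2l.
have bm c : bmeas (fun x => c * ((is_prefix s x)%:R * h x)).
  apply: bmeasZ; apply: bmeas_c; apply: continuous_mul => //.
  exact: continuous_prefix.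
have bp : bmeas (fun x => K * h0 z * (is_prefix s x)%:R : R).
  by apply: bmeasZ; exact: bmeas_prefix.
apply/andP; split; apply: E_le => // x; case: (boolP (is_prefix s x)) => [/close|_];
  rewrite ?mul0r ?mulr0// mul1r mulr1 hE mulrCA ler_pM2l// -expRD ler_expR ler_norml => /andP[]; lra.
Qed.

End eigendata.

(** * Approximation of partitions by cylinders *)

Section approximation.
Context {R : realType}.

Definition cylindrical (T : Type) (C : Omega -> T) : Prop :=
  exists k, forall x y, agree k x y -> C x = C y.

Lemma cylindrical_measurable (C : Omega -> bool) : cylindrical C -> measurable [set x | C x].
Proof.
move=> [k H]; apply: measurable_open; rewrite openE => x Cx.
by apply: filterS (nbhs_agree k x) => y /H; rewrite /= => <-.
Qed.

Lemma cylindrical2 (T1 T2 T : Type) (op : T1 -> T2 -> T) C D :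
  cylindrical C -> cylindrical D -> cylindrical (fun x => op (C x) (D x)).
Proof.
move=> [k HC] [l HD]; exists (maxn k l) => x y xy.
congr op; [apply: HC|apply: HD]; apply: agree_le xy; [exact: leq_maxl|exact: leq_maxr].
Qed.

Lemma measurable_mem (A : set Omega) : measurable A -> measurable [set x | x \in A].
Proof. by rewrite set_mem_set. Qed.

Lemma measurable_bool1 (op : bool -> bool) (q : Omega -> bool) :
  measurable [set x | q x] -> measurable [set x | op (q x)].
Proof.
move=> mq; case Et : (op true); case Ef : (op false).
- rewrite (_ : [set _ | _] = setT)//; apply/seteqP; split => x //= _.
  by case: (q x).
- rewrite (_ : [set _ | _] = [set x | q x])//; apply/seteqP; split => x /=;
  by case: (q x); rewrite ?Et ?Ef.
- rewrite (_ : [set _ | _] = ~` [set x | q x]); first exact: measurableC.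
  by apply/seteqP; split => x /=; case: (q x); rewrite ?Et ?Ef.
- rewrite (_ : [set _ | _] = set0)//; apply/seteqP; split => x //=.
  by case: (q x); rewrite ?Et ?Ef.
Qed.

Lemma measurable_bool2 (op : bool -> bool -> bool) (p q : Omega -> bool) :
  measurable [set x | p x] -> measurable [set x | q x] ->
  measurable [set x | op (p x) (q x)].
Proof.
move=> mp mq.
rewrite (_ : [set _ | _] = ([set x | p x] `&` [set x | op true (q x)]) `|`
   (~` [set x | p x] `&` [set x | op false (q x)])); last first.
  apply/seteqP; split => x /=; case: (p x) => //=.
  - by left.
  - by right.
  - by case=> -[].
  - by case=> -[].
apply: measurableU; apply: measurableI; do ?exact: measurable_bool1; first exact: mp.
exact: measurableC.
Qed.

(** The sets that can be approximated form a sigma-algebra that contains the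
    cylinders. A countable union is first cut to a finite one, by continuity of
    the measure from below. *)
Lemma cylinder_approximation (rho : probability Omega R) (A : set Omega) :
  measurable A -> forall e, 0 < e ->
  exists2 C : Omega -> bool, cylindrical C &
    \int[rho]_x ((x \in A) (+) C x)%:R <= e.
Proof.
pose G : set (set Omega) := [set A | measurable A /\ forall e, 0 < e ->
  exists2 C : Omega -> bool, cylindrical C &
    \int[rho]_x ((x \in A) (+) C x)%:R <= e].
have bx (B : set Omega) (C : Omega -> bool) : measurable B -> cylindrical C ->
    bmeas (fun x : Omega => ((x \in B) (+) C x)%:R : R).
  move=> mB cC; apply: bmeas_bool; apply: (measurable_bool2 addb).
    exact: (measurable_mem mB).
  exact: cylindrical_measurable.
have bB (B : set Omega) : measurable B -> bmeas (fun x : Omega => (x \in B)%:R : R).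
  by move=> mB; apply: (@bmeas_bool _ _ R (fun x => x \in B)); exact: (measurable_mem mB).
have G0 : G set0.
  split => // e e0; exists xpred0; first by exists 0%N.
  under eq_Rintegral do rewrite in_set0 /=.
  by rewrite E_cst ltW.
have GC B : G B -> G (~` B).
  move=> [mB HB]; split; first exact: measurableC.
  move=> e /HB[C cC eC]; exists (fun x => ~~ C x).
    by case: cC => k H; exists k => x y /H ->.
  apply: le_trans eC; rewrite le_eqVlt; apply/predU1P; left.
  by apply: eq_Rintegral => x _; rewrite in_setC addbN addNb negbK.
have GU B D : G B -> G D -> G (B `|` D).
  move=> [mB HB] [mD HD]; split; first exact: measurableU.
  move=> e e0; have e2 : 0 < e / 2 by rewrite divr_gt0.
  have [C1 c1 H1] := HB _ e2; have [C2 c2 H2] := HD _ e2.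
  have c12 : cylindrical (fun x => C1 x || C2 x) by exact: cylindrical2.
  exists (fun x => C1 x || C2 x) => //.
  rewrite [e]splitr (le_trans _ (lerD H1 H2))// -E_D; [|exact: bx|exact: bx].
  apply: E_le => [||x]; [by apply: bx => //; exact: measurableU|by apply: bmeasD; exact: bx|].
  rewrite in_setU -natrD ler_nat.
  by case: (x \in B); case: (x \in D); case: (C1 x); case: (C2 x).
have GF (F : (set Omega)^nat) : (forall i, G (F i)) -> G (\bigcup_i F i).
  move=> GFi; have mF i : measurable (F i) := (GFi i).1.
  have mU : measurable (\bigcup_i F i) by exact: bigcupT_measurable.
  split => // e e0; have e2 : 0 < e / 2 by rewrite divr_gt0.
  pose H n := \big[setU/set0]_(i < n) F i.
  have GH n : G (H n).
    rewrite /H; elim: n => [|n IH]; first by rewrite big_ord0.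
    by rewrite big_ord_recr; exact: GU.
  have HU : \bigcup_n H n = \bigcup_n F n.
    apply/seteqP; split => x [n _].
      by rewrite /H -bigcup_mkord => -[i /= _ Fi]; exists i.
    move=> Fn; exists n.+1 => //; rewrite /H -bigcup_mkord.
    by exists n => /=.
  have : rho \o H @ \oo --> rho (\bigcup_n H n).
    apply: nondecreasing_cvg_mu; first by move=> n; exact: (GH n).1.
      by rewrite HU.
    by move=> m n mn; apply/subsetPset; exact: subset_bigsetU.
  have -> : rho \o H = EFin \o (fine \o (rho \o H)).
    by apply/funext => n /=; rewrite probability_fineK//; exact: (GH n).1.
  rewrite HU -(probability_fineK _ mU).
  move=> /fine_cvg /= /cvgrPdist_le/(_ _ e2)[n _ /(_ n (leqnn n)) /= Hn].
  have [C cC HC] := (GH n).2 _ e2.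
  exists C => //; rewrite [e]splitr.
  have Hsub x : x \in H n -> x \in \bigcup_i F i.
    by rewrite !inE -HU => Hx; exists n.
  apply: (le_trans _ (lerD Hn HC)).
  rewrite (le_trans _ (lerD (ler_norm _) (lexx _)))//.
  rewrite -[X in fine (rho X)]set_mem_set -E_bool; last exact: (measurable_mem mU).
  rewrite -[X in _ - fine (rho X)]set_mem_set -E_bool; last exact: (measurable_mem (GH n).1).
  have bU := bB _ mU; have bH := bB _ (GH n).1.
  have bC := bx _ _ (GH n).1 cC.
  rewrite -E_B// -E_D//; last exact: bmeasB.
  apply: E_le; [exact: bx|by apply: bmeasD => //; exact: bmeasB|].
  move=> x; case: (boolP (x \in H n)) => [/Hsub ->|_]; first by rewrite subrr add0r.
  by rewrite subr0 -natrD ler_nat; case: (x \in _); case: (C x).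
suff GS : @measurable _ Omega `<=` G by move=> mA; exact: (GS A mA).2.
rewrite measurable_cylinders; apply: smallest_sub.
  by split => //; move=> B; rewrite setTD; exact: GC.
move=> _ [->//|[s ->]]; split; first exact: measurable_cyl.
move=> e e0; exists (is_prefix s).
  by exists (size s) => x y; exact: agree_prefix.
under eq_Rintegral do rewrite mem_boolE addbb /=.
by rewrite E_cst ltW.
Qed.

Lemma bmeas_neq K (P Q : Omega -> 'I_K) : finite_partition P -> cylindrical Q ->
  bmeas (fun x => (P x != Q x)%:R : R).
Proof.
move=> mP cQ.
  apply: bmeas_bool.
  have -> : [set x | P x != Q x] =
      \bigcup_(j in [set: 'I_K]) [set x | (x \in P @^-1` [set j]) && (Q x != j)].
    apply/seteqP; split => x /=.
      by move=> PQ; exists (P x) => //; apply/andP; split; [exact: mem_set|rewrite eq_sym].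
    by move=> [j _ /andP[/set_mem /= <-]]; rewrite eq_sym.
  apply: fin_bigcup_measurable => [|j _]; first exact: finite_finset.
  apply: (measurable_bool2 andb).
    exact: (measurable_mem (mP j)).
  apply: cylindrical_measurable; case: cQ => k H; exists k => x y /H ->//.
Qed.

(** Approximate each atom up to [e / K]. Where none of these approximations fails,
    exactly one approximating set contains [x], and its label is [P x]. *)
Lemma partition_approximation (rho : probability Omega R) K (P : Omega -> 'I_K) :
  finite_partition P -> forall e, 0 < e ->
  exists2 Q : Omega -> 'I_K, cylindrical Q & \int[rho]_x (P x != Q x)%:R <= e.
Proof.
move=> mP e e0.
have K0 : (0 < K)%N by case: K P {mP} => // P; case: (P (fun=> true)).
pose e' := e / K%:R.
have e'0 : 0 < e' by rewrite divr_gt0// ltr0n.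
have /choice[C HC] : forall j : 'I_K, exists C : Omega -> bool, cylindrical C /\
    \int[rho]_x ((x \in P @^-1` [set j]) (+) C x)%:R <= e'.
  by move=> j; have [C cC lC] := cylinder_approximation rho (mP j) e'0; exists C.
pose Q x := odflt (Ordinal K0) [pick j | C j x].
have cQ : cylindrical Q.
  have /choice[k Hk] : forall j, exists k, forall x y, agree k x y -> C j x = C j y.
    by move=> j; exact: (HC j).1.
  exists (\max_j k j)%N => x y xy; rewrite /Q; congr odflt; apply: eq_pick => j.
  by apply: Hk; apply: agree_le xy; exact: leq_bigmax.
have bPQ := bmeas_neq mP cQ.
exists Q => //.
have bx j : bmeas (fun x : Omega => ((x \in P @^-1` [set j]) (+) C j x)%:R : R).
  apply: bmeas_bool; apply: (measurable_bool2 addb); first exact: (measurable_mem (mP j)).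
  exact: cylindrical_measurable (HC j).1.
have -> : e = \sum_(j < K) e'.
  by rewrite sumr_const card_ord -mulr_natr divfK// pnatr_eq0 -lt0n.
apply: (@le_trans _ _ (\sum_(j < K) \int[rho]_x ((x \in P @^-1` [set j]) (+) C j x)%:R)); last first.
  by apply: ler_sum => j _; exact: (HC j).2.
rewrite -E_sum//; apply: E_le => //; first exact: bmeas_sum.
move=> x; case: (boolP (P x == Q x)) => [_|PQ] /=; first exact: sumr_ge0.
have [j Hj] : exists j, (x \in P @^-1` [set j]) (+) C j x.
  apply/not_existsP => H; move/eqP: PQ; apply; rewrite /Q.
  have CP j : C j x = (j == P x).
    have E : (x \in P @^-1` [set j]) = (j == P x).
      by apply/idP/eqP => [/set_mem /= <-//|->]; exact: mem_set.
    by move/negP: (H j); rewrite E; case: (j == _); case: (C j x).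
  by case: pickP => [j|/(_ (P x))]; rewrite CP ?eqxx// => /eqP.
by rewrite (bigD1 j)//= Hj lerDl sumr_ge0.
Qed.

End approximation.

(** * Upper bound for the entropy of a partition *)

Section invariance.
Context {R : realType}.
Variable rho : probability Omega R.
Hypothesis inv : shift_invariant rho.

Lemma bmeas_shift (f : Omega -> R) : bmeas f -> bmeas (fun x => f (Omega_shift x)).
Proof.
move=> [mf [M Mf]]; split; last by exists M.
exact: (measurableT_comp mf measurable_shift).
Qed.

Lemma bmeas_iter (f : Omega -> R) i : bmeas f -> bmeas (fun x => f (iter i Omega_shift x)).
Proof.
elim: i f => // i IH f bf.
exact: (IH (fun x => f (Omega_shift x)) (bmeas_shift bf)).
Qed.

Lemma E_shift (f : Omega -> R) : bmeas f ->
  \int[rho]_x f (Omega_shift x) = \int[rho]_x f x.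
Proof.
move=> bf; rewrite /Rintegral; congr fine.
rewrite -[LHS](@integral_pushforward _ _ Omega Omega R Omega_shift measurable_shift rho setT (EFin \o f))//.
- apply: eq_measure_integral; first exact: measurable_shift.
  by move=> ? A mA _; exact: inv.
- by apply/measurable_EFinP; exact: bf.1.
- exact: (bmeas_integrable rho (bmeas_shift bf)).
Qed.

Lemma E_iter (f : Omega -> R) i : bmeas f ->
  \int[rho]_x f (iter i Omega_shift x) = \int[rho]_x f x.
Proof.
elim: i f => // i IH f bf.
rewrite -(E_shift bf) -(IH (fun x => f (Omega_shift x)))//; exact: bmeas_shift.
Qed.

End invariance.

Section entropy_bound.
Context {R : realType}.

(** This is [ln z <= z - 1] at [z = q / p]. In the application [p] is the mass of a
    part of an atom of mass [P], which only helps. *)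
Lemma gibbs_term (p q P : R) : 0 <= p <= P -> 0 < q ->
  - (p * ln P) <= - (p * ln q) + (q - p).
Proof.
move=> /andP[p0 pP] q0; have [->|pn0] := eqVneq p 0.
  by rewrite !mul0r; lra.
have {}p0 : 0 < p by rewrite lt_neqAle eq_sym pn0.
have P0 : 0 < P := lt_le_trans p0 pP.
have lpP : ln p <= ln P by rewrite ler_ln ?posrE.
have : ln (q / p) <= q / p - 1.
  have := @le_ln1Dx R (q / p - 1); rewrite [1 + _]addrC subrK; apply.
  by rewrite ltrBrDr addrC subrr divr_gt0.
rewrite lnM ?posrE ?invr_gt0// lnV ?posrE// -(ler_pM2l p0) !mulrBr mulr1.
rewrite mulrCA mulfV// mulr1 => H.
have : p * ln p <= p * ln P by rewrite ler_pM2l.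
by lra.
Qed.

Lemma ln_spin_weight (y : R) b : - ln (spin_weight y b) = ln (2 * cosh y) - y * spin b.
Proof.
have c0 : 0 < 2 * cosh y by rewrite mulr_gt0// cosh_gt0.
rewrite /spin_weight lnM ?posrE ?expR_gt0 ?invr_gt0// expRK lnV ?posrE//.
by rewrite opprD opprK addrC.
Qed.

Lemma ln_prod I (s : seq I) (F : I -> R) : (forall i, 0 < F i) ->
  ln (\prod_(i <- s) F i) = \sum_(i <- s) ln (F i).
Proof.
move=> F0; elim: s => [|i s IH]; first by rewrite !big_nil ln1.
by rewrite !big_cons lnM ?posrE ?IH//; apply: prodr_gt0 => j _.
Qed.

Lemma ln_word_weight (y : R) s :
  - ln (word_weight y s) = \sum_(b <- s) (ln (2 * cosh y) - y * spin b).
Proof.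
rewrite /word_weight ln_prod; last exact: spin_weight_gt0.
by rewrite -sumrN; apply: eq_bigr => b _; rewrite ln_spin_weight.
Qed.

Lemma ln_word_weight_prefix (y : R) x n : - ln (word_weight y (prefix_of x n)) =
  \sum_(0 <= i < n) (ln (2 * cosh y) - y * spin (iter i Omega_shift x 0%N)).
Proof.
rewrite ln_word_weight big_map /index_iota subn0; apply: eq_bigr => i _.
by rewrite iter_shiftE addn0.
Qed.

Variable rho : probability Omega R.

Lemma bmeas_spin i : bmeas (fun x : Omega => spin (x i) : R).
Proof. by apply: continuous_bmeas; exact: continuous_spin. Qed.

Let m := \int[rho]_x spin (x 0%N) : R.

Section names.
Variables (K : nat) (P : Omega -> 'I_K).

Definition same_name n (w : {ffun 'I_n -> 'I_K}) (x : Omega) : bool :=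
  [forall i : 'I_n, P (iter i Omega_shift x) == w i].

Definition name n (x : Omega) : {ffun 'I_n -> 'I_K} :=
  [ffun i : 'I_n => P (iter i Omega_shift x)].

Lemma same_nameE n w x : same_name w x = (w == name n x).
Proof.
apply/forallP/eqP => [H|-> i]; last by rewrite ffunE.
by apply/ffunP => i; rewrite ffunE; apply/esym/eqP.
Qed.

Lemma sum_name n x (F : {ffun 'I_n -> 'I_K} -> R) :
  \sum_w (same_name w x)%:R * F w = F (name n x).
Proof.
rewrite (bigD1 (name n x))//= same_nameE eqxx mul1r big1 ?addr0// => w.
by rewrite same_nameE => /negbTE ->; rewrite mul0r.
Qed.

Hypothesis mP : finite_partition P.

Lemma measurable_same_name n w : measurable [set x | @same_name n w x].
Proof.
rewrite (_ : [set _ | _] = \bigcap_(i in [set: 'I_n])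
    ((iter i Omega_shift) @^-1` (P @^-1` [set w i]))).
  apply: fin_bigcap_measurable => [|i _]; first exact: finite_finset.
  have : measurable_fun [set: Omega] (iter i Omega_shift).
    elim: (i : nat) => [|j IH]; first exact: measurable_id.
    exact: (measurableT_comp measurable_shift IH).
  by move=> /(_ measurableT _ (mP (w i))); rewrite setTI.
apply/seteqP; split => x /=.
  by move=> /forallP H i _; exact/eqP.
by move=> H; apply/forallP => i; apply/eqP; exact: H.
Qed.

Lemma bmeas_same_name n (w : {ffun 'I_n -> 'I_K}) : bmeas (fun x => (same_name w x)%:R : R).
Proof. by apply: bmeas_bool; exact: measurable_same_name. Qed.

Lemma partition_entropyE n : partition_entropy rho P n =
  \sum_w - (\int[rho]_x (same_name w x)%:R * ln (\int[rho]_x (@same_name n w x)%:R)).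
Proof.
apply: eq_bigr => w _ /=; rewrite E_bool; last exact: measurable_same_name.
suff -> : [set x | forall i : 'I_n, P (iter i Omega_shift x) = w i] =
  [set x | same_name w x] by [].
apply/seteqP; split => x /=.
  by move=> H; apply/forallP => i; exact/eqP.
by move=> /forallP H i; exact/eqP.
Qed.

(** Gibbs' inequality for the joint law of the name and of a prefix: refining the
    names by prefixes can only increase the entropy. *)
Lemma partition_entropy_gibbs n l (q : {ffun 'I_n -> 'I_K} -> seq bool -> R) :
  (forall w c, 0 < q w c) -> \sum_w \sum_(c <- words l) q w c = 1 ->
  partition_entropy rho P n <=
  \int[rho]_x (\sum_w \sum_(c <- words l)
     (same_name w x)%:R * (is_prefix c x)%:R * - ln (q w c)).
Proof.
move=> q0 q1; rewrite partition_entropyE.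
pose p (w : {ffun 'I_n -> 'I_K}) c := \int[rho]_x ((same_name w x)%:R * (is_prefix c x)%:R) : R.
have bp (w : {ffun 'I_n -> 'I_K}) c : bmeas (fun x => (same_name w x)%:R * (is_prefix c x)%:R : R).
  by apply: bmeasM; [exact: bmeas_same_name | exact: bmeas_prefix].
have pw (w : {ffun 'I_n -> 'I_K}) : \int[rho]_x (same_name w x)%:R = \sum_(c <- words l) p w c :> R.
  rewrite -E_sum//; apply: eq_Rintegral => x _; rewrite -mulr_sumr.
  have := sum_prefix l x (fun=> 1 : R); under eq_bigr do rewrite mul1r.
  by move=> ->; rewrite mulr1.
have p1 : \sum_w \sum_(c <- words l) p w c = 1.
  under eq_bigr do rewrite -pw.
  rewrite -E_sum; last exact: bmeas_same_name.
  rewrite -[RHS](E_cst rho 1); apply: eq_Rintegral => x _.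
  apply: etrans (@sum_name n x (fun=> 1 : R)).
  by apply: eq_bigr => w _; rewrite mulr1.
have p0 w c : 0 <= p w c.
  by apply: Rintegral_ge0 => x _; rewrite mulr_ge0.
apply: (@le_trans _ _ (\sum_w \sum_(c <- words l) (- (p w c * ln (q w c)) + (q w c - p w c)))).
  apply: ler_sum => w _; rewrite pw {1}big_distrl -sumrN /=.
  rewrite big_seq [X in _ <= X]big_seq; apply: ler_sum => c cl.
  apply: gibbs_term => //; rewrite p0 /=.
  by rewrite (big_rem c)//= lerDl sumr_ge0.
under eq_bigr do rewrite big_split sumrB /=.
rewrite big_split sumrB /= q1 p1 subrr addr0.
rewrite E_sum; last by move=> w; apply: bmeas_sum => c; apply: bmeasM => //; exact: bmeas_cst.
rewrite le_eqVlt; apply/predU1P; left; apply: eq_bigr => w _.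
rewrite E_sum; last by move=> c; apply: bmeasM => //; exact: bmeas_cst.
apply: eq_bigr => c _; rewrite /p -mulrN mulrC -E_Z//.
by apply: eq_Rintegral => x _; rewrite mulrC.
Qed.

Hypothesis inv : shift_invariant rho.

(** The comparison law [q] draws a Bernoulli word of length [n + k], reads off the
    labels given by an approximation [Q] of [P] that depends on [k] coordinates,
    and with probability [eta] replaces each label by a uniform one. By invariance
    the word costs [ln (2 cosh y) - y m] per letter. A label costs
    [- ln (1 - eta) = e / 2], except on the rare event [P <> Q] where it costs
    [L = - ln (eta / K)]. *)
Lemma partition_entropy_le y e : 0 < e -> exists k : nat, forall n,
  partition_entropy rho P n <=
  (n + k)%:R * (ln (2 * cosh y) - y * m) + n%:R * e.
Proof.
move=> e0.
have K0 : (0 < K)%N by exact: leq_ltn_trans (leq0n _) (ltn_ord (P (fun=> true))).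
have KR : 0 < K%:R :> R by rewrite ltr0n.
have e2 : 0 < e / 2 by rewrite divr_gt0.
pose eta := 1 - expR (- (e / 2)).
have eta0 : 0 < eta by rewrite subr_gt0 expR_lt1 oppr_lt0.
have etaK : 0 < eta / K%:R by rewrite divr_gt0.
have etaK1 : eta / K%:R <= 1.
  rewrite ler_pdivrMr// mul1r (@le_trans _ _ 1)//.
    by rewrite lerBlDr lerDl expR_ge0.
  by rewrite ler1n.
pose L := - ln (eta / K%:R).
have L0 : 0 <= L by rewrite oppr_ge0 ln_le0.
have [Q [k cQ] lQ] := partition_approximation rho mP (divr_gt0 e2 (ltr_wpDl L0 ltr01)).
exists k => n.
pose r (j l : 'I_K) := (1 - eta) * (j == l)%:R + eta / K%:R.
have r0 j l : 0 < r j l.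
  by rewrite ltr_wpDl// mulr_ge0// subKr expR_ge0.
have r1 l : \sum_j r j l = 1.
  rewrite big_split /= -mulr_sumr sumr_const card_ord -[eta / _ *+ _]mulr_natr divfK ?gt_eqF//.
  rewrite (bigD1 l)//= eqxx big1 ?addr0 ?mulr1 ?subrK// => j /negbTE -> //.
pose Qi (c : seq bool) (i : nat) := Q (iter i Omega_shift (concat c (fun=> true))).
pose q (w : {ffun 'I_n -> 'I_K}) c := word_weight y c * \prod_i r (w i) (Qi c i).
have q0 w c : 0 < q w c.
  by rewrite mulr_gt0 ?word_weight_gt0// prodr_gt0.
have q1 : \sum_w \sum_(c <- words (n + k)) q w c = 1.
  rewrite exchange_big /= -[RHS](sum_word_weight y (n + k)); apply: eq_bigr => c _.
  rewrite -mulr_sumr -(bigA_distr_bigA (fun (i : 'I_n) j => r j (Qi c i))).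
  by rewrite big1 ?mulr1// => i _; exact: r1.
have := partition_entropy_gibbs q0 q1.
pose S x := \sum_(0 <= i < n + k) (ln (2 * cosh y) - y * spin (iter i Omega_shift x 0%N)).
pose G x := e / 2 + L * (P x != Q x)%:R.
have bPQ : bmeas (fun x => (P x != Q x)%:R : R) by by apply: bmeas_neq => //; exists k.
have bG : bmeas G by apply: bmeasD; [exact: bmeas_cst | exact: bmeasZ].
have bs : bmeas (fun x : Omega => ln (2 * cosh y) - y * spin (x 0%N)).
  by apply: bmeasB; [exact: bmeas_cst | apply: bmeasZ; exact: bmeas_spin].
have bS : bmeas S by apply: bmeas_sum => i; exact: bmeas_iter bs.
have bGn : bmeas (fun x => \sum_(0 <= i < n) G (iter i Omega_shift x)).
  by apply: bmeas_sum => i; exact: bmeas_iter.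
move=> /le_trans; apply.
apply: (@le_trans _ _ (\int[rho]_x (S x + \sum_(0 <= i < n) G (iter i Omega_shift x)))).
  apply: E_le; last move=> x.
  - apply: bmeas_sum => w; apply: bmeas_sum => c; apply: bmeasM; last exact: bmeas_cst.
    by apply: bmeasM; [exact: bmeas_same_name | exact: bmeas_prefix].
  - exact: bmeasD.
  rewrite (_ : \sum_w _ = - ln (q (name n x) (prefix_of x (n + k)))); last first.
    rewrite -(sum_name x (fun w => - ln (q w _))); apply: eq_bigr => w _.
    rewrite -(sum_prefix _ x (fun c => - ln (q w c))) mulr_sumr.
    by apply: eq_bigr => c _; rewrite -mulrA [_ * - ln _]mulrC.
  rewrite /q lnM ?posrE ?word_weight_gt0//; last exact: prodr_gt0.
  rewrite opprD ln_word_weight_prefix lerD2l ln_prod//.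
  rewrite -sumrN big_mkord; apply: ler_sum => i _; rewrite ffunE.
  have -> : Qi (prefix_of x (n + k)) i = Q (iter i Omega_shift x).
    apply: cQ => j jk; rewrite !iter_shiftE; apply/esym/(prefix_concat x (n + k)).2.
    by rewrite -addnS leq_add// ltnW.
  rewrite /G /r; set z := iter _ _ _.
  case: (P z == Q z); rewrite /= ?mulr0 ?mulr1 ?addr0 ?add0r.
    rewrite lerNl -[leLHS]expRK ler_ln ?posrE ?expR_gt0//.
      by rewrite subKr lerDl ltW.
    by rewrite ltr_pwDr// subKr expR_ge0.
  by rewrite lerDr ltW.
rewrite E_D// /S E_sum; last by move=> i; exact: bmeas_iter bs.
rewrite E_sum; last by move=> i; exact: bmeas_iter.
rewrite (eq_bigr (fun=> ln (2 * cosh y) - y * m)); last first.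
  move=> i _; rewrite (E_iter inv i bs) E_B; [|exact: bmeas_cst|by apply: bmeasZ; exact: bmeas_spin].
  by rewrite E_cst E_Z//; exact: bmeas_spin.
rewrite [X in _ + X](eq_bigr (fun=> \int[rho]_x G x)); last first.
  by move=> i _; rewrite (E_iter inv i bG).
rewrite !sumr_const_nat !subn0 -[X in X + _]mulr_natl -[X in _ + X]mulr_natl lerD2l.
rewrite ler_wpM2l// /G E_D; [|exact: bmeas_cst|exact: bmeasZ].
rewrite E_cst E_Z// [leRHS]splitr lerD2l (le_trans (ler_wpM2l L0 lQ))//.
by rewrite mulrA ler_pdivrMr ?ltr_wpDl// mulrC ler_pM2l// lerDl.
Qed.

End names.
End entropy_bound.

(** * The variational principle and self-consistency *)

Section entropy.
Context {R : realType}.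
Implicit Types (rho : probability Omega R) (y : R).

Definition magnetization rho : R := \int[rho]_x spin (x 0%N).

Lemma magnetization_norm rho : `|magnetization rho| <= 1.
Proof.
rewrite -[X in `|X|]subr0 -(E_cst rho 0).
apply: E_dist; [exact: bmeas_spin|exact: bmeas_cst|] => x.
by rewrite subr0 spin_norm.
Qed.

Lemma entropy_bound_ge0 rho y : 0 <= ln (2 * cosh y) - y * magnetization rho.
Proof.
rewrite subr_ge0 -[leLHS]expRK ler_ln ?posrE ?expR_gt0 ?mulr_gt0 ?cosh_gt0//.
apply: (@le_trans _ _ (expR `|y|)).
  rewrite ler_expR (le_trans (ler_norm _))// normrM ler_piMr//.
  exact: magnetization_norm.
rewrite /cosh mulrC divfK//; case: (ger0P y) => _.
  by rewrite lerDl expR_ge0.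
  by rewrite lerDr expR_ge0.
by rewrite addr_gt0 ?expR_gt0.
Qed.

Lemma KS_entropy_le rho y : shift_invariant rho ->
  (KS_entropy rho <= (ln (2 * cosh y) - y * magnetization rho)%:E)%E.
Proof.
move=> inv; apply: ge_ereal_sup => _ [K [P [mP ->]]]; rewrite lee_fin.
set a := ln _ - _; have a0 : 0 <= a := entropy_bound_ge0 rho y.
(* a divergent sequence has the default limit 0, which is below the bound *)
have [cv|/dvgP ->//] := pselect (cvgn (fun n => partition_entropy rho P n / n%:R)).
apply/ler_addgt0Pl => e e0; have e2 : 0 < e / 2 by rewrite divr_gt0.
have [k Hk] := partition_entropy_le mP inv y e2.
apply: limr_le => //; near=> n.
have n0 : 0 < n%:R :> R.
  by rewrite ltr0n; near: n; exact: nbhs_infty_gt.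
rewrite ler_pdivrMr// (le_trans (Hk n))// natrD -/a.
have : k%:R * a / (e / 2) <= n%:R by near: n; exact: nbhs_infty_ger.
rewrite ler_pdivrMr//; rewrite -/(magnetization rho) -/a; nra.
Unshelve. all: by end_near. Qed.

Section bernoulli.
Variables (rho : probability Omega R) (y : R).
Hypothesis rhoE : forall s, rho (cyl s) = (word_weight y s)%:E.

Lemma bernoulli_invariant : shift_invariant rho.
Proof.
move=> A mA.
have := @measure_cyl_unique R (pushforward rho Omega_shift) rho.
apply => //.
- exact: measurable_shift.
- move=> mshift; rewrite /= /pushforward preimage_setT.
  by have /= -> := probability_setT rho; rewrite ltry.
move=> mshift s.
have E : rho (Omega_shift @^-1` cyl s) = (rho (cyl (true :: s)) + rho (cyl (false :: s)))%E.
  rewrite -measureU; [|exact: measurable_cyl|exact: measurable_cyl|]; last first.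
    by apply/seteqP; split => x // -[/andP[/eqP xt _] /andP[/eqP]]; rewrite xt.
  congr (rho _); apply/seteqP; split => x /=.
    by rewrite /cyl /=; case: (x 0%N) => /= H; [left|right].
  by case=> /andP[].
rewrite [LHS]E !rhoE !word_weight_cons -EFinD -mulrDl spin_weight_sum mul1r.
by rewrite -rhoE.
Qed.

(** For the partition by the first coordinate, the information of a name is the
    Birkhoff sum of [ln (2 cosh y) - y x_0], so the bound of [KS_entropy_le] is
    attained for each length. *)
Lemma bernoulli_entropy_ge :
  ((ln (2 * cosh y) - y * magnetization rho)%:E <= KS_entropy rho)%E.
Proof.
set a := ln _ - _.
pose P (x : Omega) : 'I_2 := if x 0%N then ord_max else ord0.
have mP : finite_partition P.
  move=> j.
  have -> : P @^-1` [set j] = [set x | (P x == j)].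
    by apply/seteqP; split => x /= /eqP.
  apply: cylindrical_measurable; exists 1%N => x z xz; by rewrite /P xz.
apply: ereal_sup_ubound; exists 2%N, P; split => //; congr (_%:E).
apply/esym/cvg_lim => //.
suff H n : partition_entropy rho P n = n%:R * a.
  apply: (cvg_near_cst a); exists 1%N => // n /= n0.
  by rewrite H mulrAC mulfV ?mul1r// pnatr_eq0 -lt0n.
pose z n (w : {ffun 'I_n -> 'I_2}) : Omega := fun i => if insub i is Some j then w j == ord_max else true.
have cE (w : {ffun 'I_n -> 'I_2}) : [set x | same_name P w x] = cyl (prefix_of (z n w) n).
  rewrite -agree_cylE; apply/seteqP; split => x /=.
    move=> /forallP H i ni; rewrite /z insubT /=.
    have /eqP <- := H (Ordinal ni); rewrite /P iter_shiftE addn0 /=.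
    by case: (x i).
  move=> H; apply/forallP => i; rewrite /P iter_shiftE addn0 H// /z.
  have -> : insub (i : nat) = Some i := valK i.
  by case: (w i) => -[|[|//]] ? ; rewrite /= -val_eqE.
rewrite partition_entropyE//.
have pE (w : {ffun 'I_n -> 'I_2}) : \int[rho]_x (same_name P w x)%:R = word_weight y (prefix_of (z n w) n).
  by rewrite E_bool ?cE ?rhoE//; exact: measurable_cyl.
under eq_bigr do rewrite {2}pE -mulrN.
have bN := bmeas_same_name mP.
transitivity (\int[rho]_x \sum_(w : {ffun 'I_n -> 'I_2}) (same_name P w x)%:R * - ln (word_weight y (prefix_of (z n w) n))).
  rewrite E_sum; last by move=> w; apply: bmeasM => //; exact: bmeas_cst.
  by apply: eq_bigr => w _; rewrite mulrC -E_Z//; apply: eq_Rintegral => x _; rewrite mulrC.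
have bs : bmeas (fun x : Omega => ln (2 * cosh y) - y * spin (x 0%N)).
  by apply: bmeasB; [exact: bmeas_cst | apply: bmeasZ; exact: bmeas_spin].
transitivity (\int[rho]_x \sum_(0 <= i < n) (ln (2 * cosh y) - y * spin (iter i Omega_shift x 0%N))).
  apply: eq_Rintegral => x _; rewrite -ln_word_weight_prefix.
  rewrite (sum_name P x (fun w => - ln (word_weight y (prefix_of (z n w) n)))).
  congr (- ln (word_weight y _)).
  apply: (@eq_from_nth _ true) => [|i]; rewrite size_mkseq ?size_mkseq// => ni.
  rewrite !nth_mkseq// /z insubT /= ffunE /P iter_shiftE addn0 /=.
  by case: (x i).
rewrite E_sum; last by move=> i; exact: bmeas_iter bs.
rewrite (eq_bigr (fun=> a)); last first.
  move=> i _; rewrite (E_iter bernoulli_invariant i bs) E_B; [|exact: bmeas_cst|by apply: bmeasZ; exact: bmeas_spin].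
  by rewrite E_cst E_Z//; exact: bmeas_spin.
by rewrite sumr_const_nat subn0 mulr_natl.
Qed.

End bernoulli.

Section density.
Context d (T : measurableType d).
Variables (P : probability T R) (h : T -> R).
Hypotheses (bh : bmeas h) (h0 : forall x, 0 <= h x) (h1 : \int[P]_x h x = 1).

(** The hypotheses are arguments of the definition because the structure of
    probability depends on them. *)
Definition density_measure of bmeas h & (forall x, 0 <= h x) & \int[P]_x h x = 1 :
  set T -> \bar R := fun U => (\int[P]_(x in U) (h x)%:E)%E.

Let nu := density_measure bh h0 h1.

Let nu0 : nu set0 = 0%E.
Proof. by rewrite /nu /density_measure integral_set0. Qed.

Let nu_ge0 U : (0 <= nu U)%E.
Proof. by apply: integral_ge0 => x _; rewrite lee_fin. Qed.

Let nu_sigma_additive : semi_sigma_additive nu.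
Proof.
move=> F mF tF mUF; rewrite /nu /density_measure; apply: cvg_toP.
  apply: ereal_nondecreasing_is_cvgn => m n mn.
  apply: lee_sum_nneg_natr => // k _ _.
  by apply: integral_ge0 => x _; rewrite lee_fin.
rewrite ge0_integral_bigcup//=.
- by apply: measurable_funTS; apply/measurable_EFinP; exact: bh.1.
- by move=> x _; rewrite lee_fin.
Qed.

HB.instance Definition _ := isMeasure.Build _ _ _ nu nu0 nu_ge0 nu_sigma_additive.

Let nu_setT : nu [set: T] = 1%:E.
Proof.
rewrite /nu /density_measure -h1 /Rintegral fineK//.
exact: integrable_fin_num (bmeas_integrable P bh).
Qed.

HB.instance Definition _ := @Measure_isProbability.Build _ _ R nu nu_setT.

Lemma density_probability : exists Q : probability T R,
  forall p : T -> bool, measurable [set x | p x] ->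
    Q [set x | p x] = (\int[P]_x ((p x)%:R * h x))%:E.
Proof.
exists (nu : probability T R) => p mp.
rewrite /= /nu /density_measure integral_mkcond /Rintegral fineK; last first.
  by apply: integrable_fin_num => //; apply: bmeas_integrable; apply: bmeasM => //; exact: bmeas_bool.
apply: eq_integral => x _; rewrite patchE mem_boolE.
by case: (p x); rewrite ?mul1r ?mul0r.
Qed.

End density.

Lemma exp_mul_le1 (d : R) : expR d * (1 - d) <= 1.
Proof.
have E : expR d * expR (- d) = 1 by rewrite -expRD subrr expR0.
by rewrite -[leRHS]E ler_pM2l ?expR_gt0// expR_ge1Dx.
Qed.

(** [y] minimizes [y' |-> ln (2 cosh y') - y' m], and the conclusion says that the
    derivative vanishes there. Comparing with [y + d] and using
    [exp d <= 1 / (1 - d)] gives [d D <= d^2 C] for [|d| < 1], where [D] is the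
    difference of the two sides. *)
Lemma equilibrium_slope y m :
  (forall y', ln (2 * cosh y) - y * m <= ln (2 * cosh y') - y' * m) ->
  m * (expR y + expR (- y)) = expR y - expR (- y).
Proof.
move=> H.
have e0 z : 0 < 2 * cosh z :> R by rewrite mulr_gt0// cosh_gt0.
set p := expR y; set q := expR (- y).
have p0 : 0 < p := expR_gt0 _; have q0 : 0 < q := expR_gt0 _.
have key d : -1 < d < 1 -> d * (m * (p + q) - (p - q)) <= d ^+ 2 * ((p + q) * (1 + `|m|)).
  move=> /andP[d1 d2].
  have e2 z : 2 * cosh z = expR z + expR (- z) by rewrite /cosh mulrC divfK.
  have h1 : (p + q) * expR (d * m) <= p * expR d + q * expR (- d).
    rewrite /p /q -!expRD -opprD -!e2 -[X in X * _ <= _]lnK ?posrE//.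
    rewrite -[leRHS]lnK ?posrE// -expRD ler_expR.
    by have := H (y + d); rewrite mulrDl; lra.
  have h2 : (p + q) * (1 + d * m) <= p * expR d + q * expR (- d).
    by apply: le_trans h1; rewrite ler_pM2l ?addr_gt0// expR_ge1Dx.
  have h3 := exp_mul_le1 d; have h4 := exp_mul_le1 (- d); rewrite opprK in h4.
  have d0 : 0 <= (1 - d) * (1 + d) by rewrite mulr_ge0//; lra.
  have h5 : (p + q) * (1 + d * m) * ((1 - d) * (1 + d)) <= p * (1 + d) + q * (1 - d).
    apply: (le_trans (ler_wpM2r d0 h2)).
    have -> : (p * expR d + q * expR (- d)) * ((1 - d) * (1 + d)) =
      p * (1 + d) * (expR d * (1 - d)) + q * (1 - d) * (expR (- d) * (1 + d)) by ring.
    by rewrite lerD// ler_piMr// mulr_ge0 ?ltW//; lra.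
  have h6 : d * m <= `|m|.
    rewrite (le_trans (ler_norm _))// normrM ler_piMl// ler_norml; lra.
  have h7 : d ^+ 2 * ((p + q) * (1 + d * m)) <= d ^+ 2 * ((p + q) * (1 + `|m|)).
    apply: ler_wpM2l; first exact: sqr_ge0.
    by apply: ler_wpM2l; [rewrite addr_ge0 ?ltW | rewrite lerD2l].
  apply: le_trans h7; move: h5.
  rewrite expr2; lra.
apply/eqP; rewrite -subr_eq0; apply/negPn/negP => D0.
set D := _ - (p - q) in D0 key *; set C := _ * _ in key.
have C0 : 0 < C.
  by apply: mulr_gt0; [exact: addr_gt0 | apply: ltr_pwDl].
have nD : 0 < `|D| by rewrite normr_gt0.
(* small enough that the quadratic term cannot compensate [d * D] *)
pose d := D / (2 * (C + `|D|)).
have CD : 0 < 2 * (C + `|D|) by rewrite mulr_gt0// addr_gt0.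
have d1 : -1 < d < 1.
  rewrite -ltr_norml /d normrM normfV [X in _ / X]gtr0_norm// ltr_pdivrMr// mul1r.
  by rewrite mulr_natl mulr2n; lra.
have DE : D = d * (2 * (C + `|D|)) by rewrite /d divfK ?gt_eqF.
have := key d d1; rewrite [in X in X -> _]DE.
have d2 : 0 < d ^+ 2 by rewrite exprn_even_gt0//= mulf_neq0// invr_neq0// gt_eqF.
rewrite mulrA -expr2 ler_pM2l//; lra.
Qed.

End entropy.

Section self_consistency.
Context {R : realType}.
Variables (g u : Omega -> R) (A beta t : R).
Hypothesis cu : continuous u.
Hypothesis gE : forall x, g x = A * spin (x 0%N) + u (Omega_shift x) - u x.

Lemma continuous_cohomologous : continuous g.
Proof.
have -> : g = fun x => A * spin (x 0%N) + u (Omega_shift x) + (-1) * u x.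
  by apply/funext => x; rewrite gE mulN1r.
apply: continuous_add; first apply: continuous_add.
- by apply: continuous_mul; [exact: continuous_cst | exact: continuous_spin].
- exact: continuous_comp_shift.
- by apply: continuous_mul => //; exact: continuous_cst.
Qed.

(** The coboundary integrates to zero. *)
Lemma E_cohomology (rho : probability Omega R) : shift_invariant rho ->
  \int[rho]_x g x = A * magnetization rho.
Proof.
move=> inv; have bu := continuous_bmeas cu.
have bA : bmeas (fun x : Omega => A * spin (x 0%N)) by apply: bmeasZ; exact: bmeas_spin.
under eq_Rintegral do rewrite gE.
rewrite E_B//; last by apply: bmeasD => //; exact: bmeas_shift.
rewrite E_D//; last exact: bmeas_shift.
rewrite E_shift// addrK E_Z//; exact: bmeas_spin.
Qed.

Lemma E_tilted (rho : probability Omega R) c : shift_invariant rho ->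
  \int[rho]_x tilted_potential (fun=> c) g beta t x = c + beta * t * A * magnetization rho.
Proof.
move=> inv; have bg := continuous_bmeas continuous_cohomologous.
rewrite /tilted_potential E_D; [|exact: bmeas_cst|exact: bmeasZ].
by rewrite E_cst E_Z// E_cohomology// mulrA.
Qed.

(** The Bernoulli measure [h nu] has pressure [ln (2 cosh y) - ln 2]. An equilibrium
    probability of mean spin [m] does at least as well, while for every [y'] its
    entropy is at most [ln (2 cosh y') - y' m]; hence [equilibrium_slope] applies
    and [m = tanh y]. *)
Lemma self_consistent_tanh lambda h (nu : probability Omega R) :
  ruelle_eigendata (tilted_potential (fun=> - ln 2) g beta t) lambda h nu ->
  self_consistent (fun=> - ln 2) g beta t ->
  let y := beta * t * A in
  t * (expR y + expR (- y)) = A * (expR y - expR (- y)).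
Proof.
move=> D [rho [[inv rho_max] tE]] y.
have ch := hoelder_continuous D.
have [rho' rho'E] := @density_probability R _ Omega nu h (continuous_bmeas ch)
  (fun x => ltW (eigenfunction_gt0 D x)) (eigenfunction_normalized D).
have {}rho'E s : rho' (cyl s) = (word_weight y s)%:E.
  rewrite rho'E; last exact: measurable_cyl.
  by rewrite (eigenprobability_cyl cu gE D).
have inv' := bernoulli_invariant rho'E.
have := rho_max _ inv'; rewrite /pressure !E_tilted// => le1.
rewrite tE E_cohomology// -mulrA; congr (_ * _); apply: equilibrium_slope => y'.
have := le_trans (leeD2l _ (bernoulli_entropy_ge rho'E)) (le_trans le1 (leeD2l _ (KS_entropy_le y' inv))).
rewrite -!EFinD lee_fin -/y; lra.
Qed.

End self_consistency.

(** * Concentration of the Curie-Weiss magnetization *)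

Section free_energy.
Context {R : realType}.
Implicit Types y v w b : R.

Definition sinh y : R := (expR y - expR (- y)) / 2.

Lemma is_derive_cosh y : is_derive y (1 : R) cosh (sinh y).
Proof.
rewrite /cosh /sinh; apply: is_derive_eq.
by rewrite /GRing.scale /=; field.
Qed.

Lemma is_derive_sinh y : is_derive y (1 : R) sinh (cosh y).
Proof.
rewrite /cosh /sinh; apply: is_derive_eq.
by rewrite /GRing.scale /=; field.
Qed.

Lemma cosh_sinh y : cosh y ^+ 2 - sinh y ^+ 2 = 1.
Proof.
have E : expR y * expR (- y) = 1 by rewrite -expRD subrr expR0.
by rewrite -[RHS]E /cosh /sinh; field.
Qed.

Lemma mean_value (f df : R -> R) v w : v < w ->
  (forall z, is_derive z (1 : R) f (df z)) ->
  exists2 z, v < z < w & f w - f v = df z * (w - v).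
Proof.
move=> vw fE; have cf : {within `[v, w], continuous f}.
  apply: continuous_subspaceT => z; apply: differentiable_continuous.
  by apply/derivable1_diffP; exact: ex_derive.
have [z] := @MVT R f df v w vw (fun x _ => fE x) cf.
by rewrite in_itv /= => zI E; exists z.
Qed.

Lemma cosh_ge1 y : 1 <= cosh y.
Proof.
rewrite /cosh ler_pdivlMr// mul1r.
by have := expR_ge1Dx y; have := expR_ge1Dx (- y); lra.
Qed.

Lemma sinh_gt0 y : 0 < y -> 0 < sinh y.
Proof. by move=> y0; rewrite divr_gt0// subr_gt0 ltr_expR; lra. Qed.

Lemma cosh_lt v w : 0 <= v -> v < w -> cosh v < cosh w.
Proof.
move=> v0 vw; rewrite -subr_gt0.
have [z /andP[vz _] ->] := mean_value vw is_derive_cosh.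
by rewrite mulr_gt0 ?subr_gt0// sinh_gt0// (le_lt_trans v0).
Qed.

Definition tanh y : R := sinh y / cosh y.

Lemma is_derive_tanh y : is_derive y (1 : R) tanh ((cosh y ^+ 2)^-1).
Proof.
have c0 : cosh y != 0 by rewrite gt_eqF// cosh_gt0.
have dc := is_derive_cosh y; have ds := is_derive_sinh y.
have dV := is_deriveV c0 dc.
apply: (is_derive_eq (is_deriveM ds dV)).
rewrite /GRing.scale /= -[X in _ = X]mul1r -(cosh_sinh y); field.
exact: c0.
Qed.

(** Concavity of [tanh] on the positive axis: its derivative [1 / cosh^2] is smaller
    at a point between [v] and [w] than at a point between [0] and [v]. *)
Lemma tanh_ratio v w : 0 < v -> v < w -> v * tanh w < w * tanh v.
Proof.
move=> v0 vw.
have t0 : tanh 0 = 0 by rewrite /tanh /sinh oppr0 subrr !mul0r.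
have [c1 /andP[c10 c1v]] := mean_value v0 is_derive_tanh; rewrite t0 !subr0 => E1.
have [c2 /andP[c2v c2w] E2] := mean_value vw is_derive_tanh.
have c12 : (cosh c2 ^+ 2)^-1 < (cosh c1 ^+ 2)^-1.
  rewrite ltf_pV2 ?posrE ?exprn_gt0 ?cosh_gt0//.
  by rewrite ltr_pXn2r ?nnegrE ?ltW ?cosh_gt0// cosh_lt// ?ltW// (lt_trans c1v).
have -> : tanh w = tanh v + (cosh c2 ^+ 2)^-1 * (w - v) by rewrite -E2; ring.
rewrite E1; move: c12; set p := _^-1; set q := _^-1 => pq.
have : p * (v * (w - v)) < q * (v * (w - v)).
  by rewrite ltr_pM2r// mulr_gt0// subr_gt0.
by lra.
Qed.

(** The exponential of the free energy functional [ln (cosh (b v)) - b v^2 / 2] of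
    the Curie-Weiss model. *)
Definition phi b v : R := cosh (b * v) * expR (- (b * v ^+ 2 / 2)).

Lemma phi_gt0 b v : 0 < phi b v.
Proof. by rewrite mulr_gt0 ?cosh_gt0 ?expR_gt0. Qed.

Lemma phi_abs b v : phi b `|v| = phi b v.
Proof.
rewrite /phi real_normK ?num_real//; congr (_ * _).
by case: (ger0P v) => //; rewrite mulrN coshN.
Qed.

Lemma is_derive_phi b v :
  is_derive v (1 : R) (phi b) (b * phi b v * (tanh (b * v) - v)).
Proof.
have c0 : cosh (b * v) != 0 by rewrite gt_eqF// cosh_gt0.
have d1 : is_derive v (1 : R) (fun z => b * z) b.
  by apply: is_derive_eq; rewrite /GRing.scale /=; ring.
have d2 : is_derive v (1 : R) (fun z => expR (- (b * z ^+ 2 / 2)))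
    (expR (- (b * v ^+ 2 / 2)) * - (b * v)).
  by apply: is_derive_eq; rewrite /GRing.scale /=; field.
have d3 := is_derive1_comp (is_derive_cosh (b * v)) d1.
apply: (is_derive_eq (is_deriveM d3 d2)).
rewrite /GRing.scale /= /phi /tanh; field.
exact: c0.
Qed.

Section maximum.
Variables (b m : R).
Hypotheses (b0 : 0 < b) (m0 : 0 < m) (mE : tanh (b * m) = m).

Lemma phi_increasing v w : 0 <= v -> v < w -> w <= m -> phi b v < phi b w.
Proof.
move=> v0 vw wm; rewrite -subr_gt0.
have [z /andP[vz zw] ->] := mean_value vw (is_derive_phi b).
have z0 : 0 < z := le_lt_trans v0 vz.
have := @tanh_ratio (b * z) (b * m); rewrite mE ltr_pM2l// => H.
have {H} := H (mulr_gt0 b0 z0) (lt_le_trans zw wm).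
rewrite mulrAC ltr_pM2l; last exact: mulr_gt0.
move=> zt; apply: mulr_gt0; last by rewrite subr_gt0.
by apply: mulr_gt0; [exact: mulr_gt0 (phi_gt0 _ _) | rewrite subr_gt0].
Qed.

Lemma phi_decreasing v w : m <= v -> v < w -> phi b w < phi b v.
Proof.
move=> mv vw; rewrite -subr_lt0.
have [z /andP[vz zw] ->] := mean_value vw (is_derive_phi b).
have mz : m < z := le_lt_trans mv vz.
have := @tanh_ratio (b * m) (b * z); rewrite mE ltr_pM2l// => H.
have {H} := H (mulr_gt0 b0 m0) mz.
rewrite [X in _ < X]mulrAC ltr_pM2l; last exact: mulr_gt0.
move=> tz; rewrite pmulr_llt0 ?subr_gt0// pmulr_rlt0; first by rewrite subr_lt0.
exact: mulr_gt0 (phi_gt0 _ _).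
Qed.

(** On the positive axis [phi b] increases up to [m] and decreases afterwards, and it
    is even. *)
Lemma phi_gap d : 0 < d -> exists2 th, 0 < th < 1 &
  forall v, d <= `| `|v| - m | -> phi b v <= th * phi b m.
Proof.
move=> d0; pose l := if d <= m then phi b (m - d) else phi b (m + d).
have pm := phi_gt0 b m.
have lm : 0 < l < phi b m.
  rewrite /l; case: ifP => dm; rewrite phi_gt0 /=; [apply: phi_increasing => //|apply: phi_decreasing => //]; lra.
have rm : 0 < phi b (m + d) < phi b m.
  by rewrite phi_gt0 /=; apply: phi_decreasing => //; lra.
exists (Num.max l (phi b (m + d)) / phi b m).
  rewrite divr_gt0//=; last by rewrite lt_max; case/andP: lm => ->.
  by rewrite ltr_pdivrMr// mul1r gt_max; case/andP: lm => _ ->; case/andP: rm.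
move=> v; rewrite divfK ?gt_eqF// -[phi b v]phi_abs le_max.
have := normr_ge0 v; set a := `|v| => a0.
rewrite ler_normr => /orP[|] H.
  have : m + d <= a by lra.
  rewrite le_eqVlt => /predU1P[->|am]; first by rewrite lexx orbT.
  by apply/orP; right; apply/ltW/phi_decreasing => //; lra.
have : a <= m - d by lra.
have dm : d <= m by lra.
rewrite /l dm le_eqVlt => /predU1P[->|am]; first by rewrite lexx.
by apply/orP; left; apply/ltW/phi_increasing => //; lra.
Qed.

End maximum.
End free_energy.

Section magnetization_words.
Context {R : realType}.

Lemma magn_cat s w : magn (s ++ w) = magn s + magn w :> R.
Proof. by rewrite /magn big_cat. Qed.

Lemma magn_norm s : `|magn s : R| <= (size s)%:R.
Proof.
elim: s => [|b s IH]; first by rewrite /magn big_nil normr0.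
rewrite /magn big_cons (le_trans (ler_normD _ _))// spin_norm -natr1 addrC.
by rewrite lerD.
Qed.

Lemma magn_count s : magn s = (count id s)%:R *+ 2 - (size s)%:R :> R.
Proof.
elim: s => [|b s IH]; first by rewrite /magn big_nil mul0rn subr0.
rewrite /magn big_cons -/(magn s) IH /= natrD -[(size s).+1%:R]natr1.
by case: b; rewrite /spin /= !mulr2n; ring.
Qed.

Lemma magn_neg s : magn (map negb s) = - magn s :> R.
Proof.
rewrite /magn big_map -sumrN; apply: eq_bigr => -[] _ //.
by rewrite /spin opprK.
Qed.

Lemma sum_words_neg n (F : seq bool -> R) :
  \sum_(s <- words n) F (map negb s) = \sum_(s <- words n) F s.
Proof.
elim: n F => [|n IH] F; first by rewrite !sum_words0.
by rewrite !sum_wordsS /= (IH (fun s => F (false :: s))) (IH (fun s => F (true :: s))) addrC.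
Qed.

Lemma sum_exp_magn n (c : R) :
  \sum_(s <- words n) expR (c * magn s) = (2 * cosh c) ^+ n.
Proof.
rewrite -[RHS]mul1r -[X in X * _](sum_word_weight c n) mulr_suml big_seq [RHS]big_seq.
apply: eq_bigr => s /size_words sn; rewrite word_weightE sn divfK//.
by rewrite expf_neq0// gt_eqF// mulr_gt0// cosh_gt0.
Qed.

End magnetization_words.

(** With [q = (1 + th) / 2] one has [th <= q^2], and [(n + 1) q^n] is bounded by
    Bernoulli's inequality. *)
Lemma cvg_linear_geometric (R : realType) (th : R) : 0 < th < 1 ->
  (fun n : nat => n.+1%:R * th ^+ n) @ \oo --> (0 : R).
Proof.
move=> /andP[t0 t1].
pose q := (1 + th) / 2; have q0 : 0 < q by rewrite divr_gt0//; lra.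
have q1 : q < 1 by rewrite /q; lra.
have tq : th <= q * q by rewrite /q; nra.
pose h := q^-1 - 1; have h0 : 0 < h by rewrite subr_gt0 invf_gt1.
pose C := (Num.min 1 h)^-1.
have m0 : 0 < Num.min 1 h by rewrite lt_min ltr01.
have key n : n.+1%:R * q ^+ n <= C.
  have : n.+1%:R * Num.min 1 h <= q^-1 ^+ n.
    elim: n => [|n IH]; first by rewrite mul1r expr0 ge_min lexx.
    rewrite -natr1 mulrDl mul1r exprS.
    have E : q^-1 = 1 + h by rewrite /h addrC subrK.
    rewrite {1}E mulrDl mul1r lerD//.
    apply: (@le_trans _ _ (h * 1)); first by rewrite mulr1 ge_min lexx orbT.
    by rewrite ler_pM2l// exprn_ege1// E; lra.
  rewrite exprVn => H; rewrite /C -[leRHS]mul1r ler_pdivlMr//.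
  by rewrite mulrAC -ler_pdivlMr ?exprn_gt0// mul1r.
apply: (@squeeze_cvgr _ _ _ _ (fun=> 0) (fun n => C * q ^+ n)).
- apply: nearW => n; apply/andP; split; first by rewrite mulr_ge0// exprn_ge0// ltW.
  apply: (@le_trans _ _ (n.+1%:R * (q * q) ^+ n)).
    apply: ler_wpM2l => //; apply: lerXn2r => //; rewrite nnegrE; first exact: ltW.
    exact: mulr_ge0 (ltW q0) (ltW q0).
  by rewrite exprMn mulrA ler_wpM2r// exprn_ge0// ltW.
- exact: cvg_cst.
- rewrite -[X in _ --> X](mulr0 C); apply: cvgM; first exact: cvg_cst.
  by apply: cvg_expr; rewrite gtr0_norm.
Qed.

Section curie_weiss.
Context {R : realType}.
Variables (b m : R) (k : nat).
Hypotheses (b0 : 0 < b) (m0 : m != 0) (mE : tanh (b * m) = m).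

Let v N (z : seq bool) : R := magn z / (k + N)%:R.

(** The unnormalized Curie-Weiss expectation of [V], for [N] spins in the volume
    [k + N]: the first [k] spins are frozen, but they count in the volume. *)
Definition cw_sum (V : R -> R) N : R :=
  \sum_(z <- words N) expR (b * (k + N)%:R / 2 * v N z ^+ 2) * V (v N z).

Let v_norm N z : z \in words N -> `|v N z| <= 1.
Proof.
move=> /size_words zN; rewrite /v normrM normfV [`|_%:R|]ger0_norm//.
case: (posnP (k + N)) => [->|n0]; first by rewrite invr0 mulr0.
rewrite ler_pdivrMr ?ltr0n// mul1r (le_trans (magn_norm z))// zN ler_nat.
exact: leq_addl.
Qed.

(** After linearization of the quadratic energy at [w] the spins are independent. *)
Lemma cw_sum_tilt N (w : R) : \sum_(z <- words N)
    expR (b * (k + N)%:R * (v N z * w - w ^+ 2 / 2)) =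
  2 ^+ N * (cosh (b * w) ^- k * phi b w ^+ (k + N)).
Proof.
have [n0|n0] := posnP (k + N)%N.
  have k0 : k = 0%N by apply/eqP; move/eqP: n0; rewrite addn_eq0 => /andP[].
  have N0 : N = 0%N by apply/eqP; move/eqP: n0; rewrite addn_eq0 => /andP[].
  by rewrite /v N0 k0 sum_words0 mulr0 mul0r expR0 !expr0 invr1 !mulr1.
have nn : (k + N)%:R != 0 :> R by rewrite pnatr_eq0 -lt0n.
have E z : expR (b * (k + N)%:R * (v N z * w - w ^+ 2 / 2)) =
    expR (b * w * magn z) * expR (- (b * w ^+ 2 / 2)) ^+ (k + N).
  rewrite -expRM_natl -expRD; congr expR; rewrite /v.
  by move: nn; move: (k + N)%:R => n' nn; field.
under eq_bigr do rewrite E.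
rewrite -mulr_suml sum_exp_magn /phi [(2 * _) ^+ N]exprMn.
rewrite [(_ * expR _) ^+ (k + N)]exprMn [cosh _ ^+ (k + N)]exprD.
have c0 : cosh (b * w) ^+ k != 0 by rewrite expf_neq0// gt_eqF// cosh_gt0.
by field.
Qed.

(** From [v^2 / 2 >= v w - w^2 / 2]. *)
Lemma cw_sum_ge N (w : R) :
  2 ^+ N * (cosh (b * w) ^- k * phi b w ^+ (k + N)) <= cw_sum (fun=> 1) N.
Proof.
rewrite -cw_sum_tilt /cw_sum; apply: ler_sum => z _; rewrite mulr1 ler_expR.
have bn : 0 <= b * (k + N)%:R by rewrite mulr_ge0// ltW.
rewrite -[leRHS]mulrA [2^-1 * _]mulrC; apply: ler_wpM2l => //.
have := sqr_ge0 (v N z - w); rewrite sqrrB; lra.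
Qed.

Lemma cw_sum_gt0 N : 0 < cw_sum (fun=> 1) N.
Proof.
apply: lt_le_trans (cw_sum_ge N 0).
by rewrite !mulr_gt0 ?exprn_gt0 ?invr_gt0 ?exprn_gt0 ?cosh_gt0 ?phi_gt0.
Qed.

Let far d (w : R) : bool := d <= `| `|w| - `|m| |.

Let mE' : tanh (b * `|m|) = `|m|.
Proof.
have tN y : tanh (- y) = - tanh y :> R by rewrite /tanh coshN /sinh opprK -!mulNr opprB.
by case: (ger0P m) => // _; rewrite mulrN tN mE.
Qed.

(** The density takes [N + 1] values. Linearizing at the value [w] itself is exact
    there and bounds the contribution of [w] by a multiple of [phi b w ^+ (k + N)];
    far from the maximizers this is exponentially small against [cw_sum_ge] at
    [m]. *)
Let cw_sum_far d : 0 < d ->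
  (fun N => cw_sum (fun w => (far d w)%:R) N / cw_sum (fun=> 1) N) @ \oo --> (0 : R).
Proof.
move=> d0; have m0' : 0 < `|m| by rewrite normr_gt0.
have [th /andP[th0 th1] Hth] := phi_gap b0 m0' mE' d0.
have th01 : 0 < th < 1 by rewrite th0.
pose C := cosh (b * m) ^+ k; have C0 : 0 < C by rewrite exprn_gt0// cosh_gt0.
apply: (@squeeze_cvgr _ _ _ _ (fun=> 0) (fun N => C * (N.+1%:R * th ^+ N))); last 2 first.
- exact: cvg_cst.
- rewrite -[X in _ --> X](mulr0 C); apply: cvgM; first exact: cvg_cst.
  exact: cvg_linear_geometric.
apply: nearW => N; apply/andP; split.
  rewrite divr_ge0 ?(ltW (cw_sum_gt0 N))//.
  by apply: sumr_ge0 => z _; rewrite mulr_ge0// expR_ge0.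
rewrite ler_pdivrMr ?cw_sum_gt0//.
apply: (@le_trans _ _ (C * (N.+1%:R * th ^+ N) * (2 ^+ N * (cosh (b * m) ^- k * phi b m ^+ (k + N))))); last first.
  apply: ler_wpM2l; last exact: cw_sum_ge.
  apply: mulr_ge0; first exact: ltW.
  by apply: mulr_ge0 => //; exact/exprn_ge0/ltW.
have -> : C * (N.+1%:R * th ^+ N) * (2 ^+ N * (cosh (b * m) ^- k * phi b m ^+ (k + N))) =
    N.+1%:R * (2 ^+ N * (th ^+ N * phi b m ^+ (k + N))).
  by rewrite /C; field; rewrite gt_eqF// cosh_gt0.
pose u (p : 'I_N.+1) : R := (p%:R *+ 2 - N%:R) / (k + N)%:R.
apply: (@le_trans _ _ (\sum_(p < N.+1) \sum_(z <- words N)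
    (far d (u p))%:R * expR (b * (k + N)%:R * (v N z * u p - u p ^+ 2 / 2)))).
  rewrite exchange_big /= /cw_sum big_seq [leRHS]big_seq; apply: ler_sum => z /size_words zN.
  have cz : (count id z < N.+1)%N by rewrite ltnS -zN count_size.
  rewrite (bigD1 (Ordinal cz))//= ler_wpDr//.
    by apply: sumr_ge0 => p _; rewrite mulr_ge0// expR_ge0.
  have -> : u (Ordinal cz) = v N z by rewrite /u /v magn_count zN.
  rewrite mulrC ler_wpM2l// ler_expR.
  have -> : v N z * v N z - v N z ^+ 2 / 2 = v N z ^+ 2 / 2 by rewrite expr2; field.
  by rewrite le_eqVlt; apply/predU1P; left; field.
have -> : N.+1%:R * (2 ^+ N * (th ^+ N * phi b m ^+ (k + N))) =
    \sum_(p < N.+1) (2 ^+ N * (th ^+ N * phi b m ^+ (k + N))).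
  by rewrite sumr_const card_ord mulr_natl.
apply: ler_sum => p _; rewrite -mulr_sumr cw_sum_tilt.
case: (boolP (far d (u p))) => [fp|_]; last first.
  rewrite mul0r; apply: mulr_ge0; first exact: exprn_ge0.
  apply: mulr_ge0; first exact/exprn_ge0/ltW.
  exact/exprn_ge0/ltW/phi_gt0.
rewrite mul1r ler_wpM2l ?exprn_ge0//.
apply: (@le_trans _ _ (phi b (u p) ^+ (k + N))).
  have c1 : 1 <= cosh (b * u p) ^+ k by rewrite exprn_ege1// cosh_ge1.
  apply: ler_piMl; first exact/exprn_ge0/ltW/phi_gt0.
  by rewrite invf_le1// (lt_le_trans ltr01).
have := Hth _ fp; rewrite -{1}[phi b `|m|]phi_abs normr_id phi_abs => le1.
apply: (@le_trans _ _ ((th * phi b m) ^+ (k + N))).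
  apply: lerXn2r => //; rewrite nnegrE; first exact/ltW/phi_gt0.
  exact: mulr_ge0 (ltW th0) (ltW (phi_gt0 _ _)).
rewrite [(th * _) ^+ _]exprMn; apply: ler_wpM2r.
  exact/exprn_ge0/ltW/phi_gt0.
rewrite exprD; apply: ler_piMl; first exact/exprn_ge0/ltW.
by apply: exprn_ile1; exact: ltW.
Qed.

(** The spin flip exchanges the two maximizers, so [V] may be symmetrized. The
    symmetrized function is close to a constant near both of them. *)
Lemma curie_weiss_limit (V : R -> R) : continuous V ->
  (exists D, forall w, `|w| <= 1 -> `|V w| <= D) ->
  (fun N => cw_sum V N / cw_sum (fun=> 1) N) @ \oo --> (V m + V (- m)) / 2.
Proof.
move=> cV [D VD].
set L := _ / 2; have LE : V m + V (- m) = 2 * L by rewrite /L mulrC divfK.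
have sym N : cw_sum V N = cw_sum (fun w => V (- w)) N.
  rewrite /cw_sum -[LHS]sum_words_neg; apply: eq_bigr => z _.
  by rewrite /v magn_neg mulNr sqrrN.
have D0 : 0 <= D by apply: le_trans (VD 0 _) => //; rewrite normr0.
pose M := D + D + `|2 * L|; have M0 : 0 <= M by rewrite !addr_ge0.
apply/cvgrPdist_le => e e0.
have e2 : 0 < e / 2 by rewrite divr_gt0.
have /cvgrPdist_le/(_ _ e2) [d1 /= d10 H1] := cV m.
have /cvgrPdist_le/(_ _ e2) [d2 /= d20 H2] := cV (- m).
pose d := Num.min d1 d2; have d0 : 0 < d by rewrite lt_min d10.
have /cvgrPdist_le/(_ (e / (M + 1))) := cw_sum_far d0.
have M1 : 0 < M + 1 by rewrite ltr_wpDl.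
move=> /(_ (divr_gt0 e0 M1)); apply: filterS => N.
have U0 := cw_sum_gt0 N; rewrite sub0r normrN ger0_norm; last first.
  rewrite divr_ge0 ?(ltW U0)//.
  by apply: sumr_ge0 => z _; rewrite mulr_ge0// expR_ge0.
rewrite ler_pdivrMr// => Hfar.
rewrite -[L](mulfK (lt0r_neq0 U0)) -mulrBl normrM normfV [`|cw_sum _ _|]gtr0_norm//.
rewrite ler_pdivrMr// -(ler_pM2l (ltr0Sn R 1)) -[X in X * `|_|](@ger0_norm R) // -normrM mulrBr mulrA -LE.
have pw z : z \in words N -> `|V m + V (- m) - (V (v N z) + V (- v N z))| <= e + M * (far d (v N z))%:R.
  move=> /v_norm zN; set w := v N z in zN *.
  case: (boolP (far d w)) => fw.
    rewrite mulr1 (@le_trans _ _ M)//; last by rewrite lerDr ltW.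
    rewrite LE (le_trans (ler_normB _ _))// /M.
    have a1 := VD w zN; have a2 := VD (- w); rewrite normrN in a2; have {}a2 := a2 zN.
    have := ler_normD (V w) (V (- w)); lra.
  rewrite mulr0 addr0 [e]splitr.
  have close x : `|m - x| < d -> `|V m + V (- m) - (V x + V (- x))| <= e / 2 + e / 2.
    move=> mx; have q1 : `|V m - V x| <= e / 2.
      by apply: H1 => /=; rewrite (lt_le_trans mx)// ge_min lexx.
    have q2 : `|V (- m) - V (- x)| <= e / 2.
      by apply: H2 => /=; rewrite -opprD normrN (lt_le_trans mx)// ge_min lexx orbT.
    by rewrite opprD addrACA (le_trans (ler_normD _ _))// lerD.
  move: fw; rewrite /far -ltNge => fw.
  have : `|m - w| < d \/ `|m - (- w)| < d.
    move: fw; case: (ger0P m) => _; case: (ger0P w) => _; rewrite ?opprK => fw; [left|right|right|left].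
    - by rewrite distrC.
    - by rewrite -normrN opprD addrC.
    - by rewrite addrC.
    - by rewrite addrC.
  case=> [/close //|/close]; by rewrite opprK [V (- w) + _]addrC.
have -> : 2 * cw_sum V N = cw_sum V N + cw_sum (fun w => V (- w)) N by rewrite -sym; ring.
apply: (@le_trans _ _ (e * cw_sum (fun=> 1) N + M * cw_sum (fun w => (far d w)%:R) N)).
  rewrite /cw_sum !mulr_sumr -!big_split -sumrB /= (le_trans (ler_norm_sum _ _ _))//.
  rewrite big_seq [leRHS]big_seq; apply: ler_sum => z /pw H.
  set E := expR _; have E0 : 0 < E := expR_gt0 _.
  rewrite (_ : _ - _ = E * (V m + V (- m) - (V (v N z) + V (- v N z)))); last by ring.
  rewrite normrM gtr0_norm// [leRHS](_ : _ = E * (e + M * (far d (v N z))%:R)); last by ring.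
  by rewrite ler_pM2l.
have : M * cw_sum (fun w => (far d w)%:R) N <= e * cw_sum (fun=> 1) N.
  apply: (le_trans (ler_wpM2l M0 Hfar)); rewrite mulrA; apply: ler_wpM2r; first exact: ltW.
  by rewrite mulrCA ler_piMr ?(ltW e0)// ler_pdivrMr// mul1r lerDl.
lra.
Qed.

End curie_weiss.

(** * Birkhoff sums on cylinders *)

Section log_close.
Context {R : realType}.
Implicit Types w x y : R.

(** A multiplicative error: it survives products, quotients and sums of positive
    quantities. *)
Definition log_close w x y : Prop := expR (- w) * x <= y <= expR w * x.

Lemma log_close_sym w x y : log_close w x y -> log_close w y x.
Proof.
move=> /andP[H1 H2]; apply/andP; split.
  by rewrite expRN ler_pdivrMl ?expR_gt0.
by rewrite -ler_pdivrMl ?expR_gt0// -expRN.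
Qed.

Lemma log_close_trans w w' x y z : log_close w x y -> log_close w' y z -> log_close (w + w') x z.
Proof.
move=> /andP[H1 H2] /andP[H3 H4]; apply/andP; split.
  by rewrite opprD addrC expRD -mulrA (le_trans _ H3)// ler_pM2l ?expR_gt0.
by rewrite addrC expRD -mulrA (le_trans H4)// ler_pM2l ?expR_gt0.
Qed.

Lemma log_close_add w x y x' y' :
  log_close w x y -> log_close w x' y' -> log_close w (x + x') (y + y').
Proof. by move=> /andP[? ?] /andP[? ?]; rewrite /log_close !mulrDr !lerD. Qed.

Lemma log_close_mul w c x y : 0 <= c -> log_close w x y -> log_close w (c * x) (c * y).
Proof. by move=> c0 /andP[? ?]; rewrite /log_close ![_ * (c * x)]mulrCA !ler_wpM2l. Qed.

Lemma log_close_le w w' x y : 0 <= x -> w <= w' -> log_close w x y -> log_close w' x y.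
Proof.
move=> x0 ww /andP[H1 H2]; apply/andP; split.
  by rewrite (le_trans _ H1)// ler_wpM2r// ler_expR lerN2.
by rewrite (le_trans H2)// ler_wpM2r// ler_expR.
Qed.

Lemma log_close_div w w' x y x' y' : 0 <= x -> 0 < x' -> 0 < y' ->
  log_close w x y -> log_close w' x' y' -> log_close (w + w') (x / x') (y / y').
Proof.
move=> x0 x'0 y'0 H /andP[H1 H2].
have y0 : 0 <= y by case/andP: H => + _; apply: le_trans; rewrite mulr_ge0// expR_ge0.
apply: (@log_close_trans _ _ _ (y / x')).
  by rewrite ![_ / x']mulrC; apply: log_close_mul => //; rewrite invr_ge0 ltW.
apply: log_close_mul => //; apply/andP; split.
  by rewrite expRN -invfM lef_pV2 ?posrE ?mulr_gt0 ?expR_gt0.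
rewrite -[expR w']invrK -expRN -invfM lef_pV2 ?posrE//.
by rewrite mulr_gt0 ?expR_gt0.
Qed.

Lemma log_close_cvg (r : nat -> R) q : 0 <= q ->
  (forall w, 0 < w -> \forall n \near \oo, log_close w q (r n)) -> r @ \oo --> q.
Proof.
move=> q0 H; apply/cvgrPdist_le => e e0.
have q1 : 0 < q + 1 by rewrite ltr_wpDl.
pose w := ln (1 + e / (q + 1)).
have eq0 : 0 < e / (q + 1) by rewrite divr_gt0.
have wE : expR w = 1 + e / (q + 1) by rewrite lnK// posrE addr_gt0.
have w0 : 0 < w by rewrite ln_gt0// ltrDl.
apply: filterS (H w w0) => n /andP[]; rewrite expRN wE.
have D : e / (q + 1) * q <= e.
  by rewrite mulrAC ler_pdivrMr// ler_pM2l// lerDl.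
set d := e / (q + 1) in eq0 D *.
have i1 : 1 - d <= (1 + d)^-1.
  by rewrite -[leRHS]mul1r ler_pdivlMr ?addr_gt0//; nra.
move=> h1 h2; rewrite ler_norml; apply/andP; split; nra.
Qed.

End log_close.

Section bernoulli_product.
Context {R : realType}.
Variables (rho : probability Omega R) (y : R).
Hypothesis rhoE : forall s, rho (cyl s) = (word_weight y s)%:E.

Lemma bmeas_prefix_mul (f : Omega -> R) s : bmeas f -> bmeas (fun x => (is_prefix s x)%:R * f x).
Proof. by apply: bmeasM; exact: bmeas_prefix. Qed.

(** For the indicator of a cylinder this is multiplicativity of the weight; the
    general case follows by uniform approximation. *)
Lemma bernoulli_independence (f : Omega -> R) s : continuous f ->
  \int[rho]_x ((is_prefix s x)%:R * f (iter (size s) Omega_shift x)) =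
  word_weight y s * \int[rho]_x f x.
Proof.
move=> cf; have bf := continuous_bmeas cf.
have step k : \int[rho]_x ((is_prefix s x)%:R * cyl_approx k f (iter (size s) Omega_shift x)) =
    word_weight y s * \int[rho]_x cyl_approx k f x.
  rewrite E_cyl_approx mulr_sumr.
  rewrite (@eq_Rintegral _ _ _ _ _ (fun x => \sum_(w <- words k) f (concat w (fun=> true)) * (is_prefix (s ++ w) x)%:R)).
    rewrite E_sum; last by move=> w; apply: bmeasZ; exact: bmeas_prefix.
    apply: eq_bigr => w _; rewrite E_Z; last exact: bmeas_prefix.
    by rewrite E_prefix !rhoE /= /word_weight big_cat /=; ring.
  move=> x _; rewrite /cyl_approx mulr_sumr; apply: eq_bigr => w _.
  by rewrite is_prefix_cat -mulnb natrM; ring.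
apply/eqP; rewrite -subr_eq0 -normr_le0; apply/ler_addgt0Pl => e e0; rewrite addr0.
have c0 : 0 < 1 + word_weight y s by rewrite addr_gt0// word_weight_gt0.
have e'0 : 0 < e / (1 + word_weight y s) by rewrite divr_gt0.
have [k Hk] := cyl_approxP cf e'0.
have ba := bmeas_cyl_approx k f.
rewrite -(subrKA (word_weight y s * \int[rho]_x cyl_approx k f x)) -{1}step.
rewrite (le_trans (ler_normD _ _))//.
have -> : e = e / (1 + word_weight y s) + word_weight y s * (e / (1 + word_weight y s)).
  by field; rewrite gt_eqF.
apply: lerD.
  apply: E_dist => [||x].
  - by apply: bmeas_prefix_mul; exact: bmeas_iter.
  - by apply: bmeas_prefix_mul; exact: bmeas_iter.
  - rewrite -mulrBr normrM; apply: le_trans (Hk (iter (size s) Omega_shift x)).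
    by rewrite ler_piMl// normr_nat lern1 leq_b1.
rewrite -mulrBr normrM gtr0_norm ?word_weight_gt0// ler_pM2l ?word_weight_gt0// distrC.
by apply: E_dist.
Qed.

End bernoulli_product.

Lemma maximal_entropy_bernoulli (R : realType) (mu : probability Omega R) :
  maximal_entropy_probability mu -> forall s, mu (cyl s) = (word_weight 0 s)%:E.
Proof.
move=> H s; rewrite (cylE s (fun=> true)) (H (size s)); congr (_%:E).
rewrite word_weightE mul0r expR0 mul1r /cosh oppr0 expR0 exprVn; congr (_ ^- _).
by field.
Qed.

Section birkhoff.
Context {R : realType}.
Variables (g u : Omega -> R) (A : R).
Hypothesis cu : continuous u.
Hypothesis gE : forall x, g x = A * spin (x 0%N) + u (Omega_shift x) - u x.

Lemma birkhoff_sum_prefix s x : is_prefix s x ->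
  \sum_(i < size s) g (iter i Omega_shift x) =
  A * magn s + u (iter (size s) Omega_shift x) - u x.
Proof.
elim: s x => [|b s IH] x /=.
  by rewrite big_ord0 /magn big_nil mulr0 add0r subrr.
move=> /andP[/eqP xb /IH {}IH]; rewrite big_ord_recl /= gE xb.
under eq_bigr do rewrite -iterS iterSr.
by rewrite IH -iterS iterSr /magn big_cons; ring.
Qed.

Lemma continuous_sum I (s : seq I) (F : I -> Omega -> R) :
  (forall i, continuous (F i)) -> continuous (fun x => \sum_(i <- s) F i x).
Proof.
move=> cF; elim: s => [|i s IH].
  have -> : (fun x => \sum_(i <- [::]) F i x) = fun=> 0.
    by apply/funext => x; rewrite big_nil.
  exact: continuous_cst.
have -> : (fun x => \sum_(j <- i :: s) F j x) = fun x => F i x + \sum_(j <- s) F j x.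
  by apply/funext => x; rewrite big_cons.
exact: continuous_add.
Qed.

Variable beta : R.

Definition gibbs_weight n x := expR (beta * n%:R / 2 * birkhoff g n x ^+ 2).

Lemma continuous_energy n :
  continuous (fun x => beta * n%:R / 2 * birkhoff g n x ^+ 2).
Proof.
have cb : continuous (birkhoff g n).
  have -> : birkhoff g n = fun x => n%:R^-1 * \sum_(i <- index_enum 'I_n) g (iter i Omega_shift x).
    by apply/funext => x; rewrite /birkhoff mulrC.
  apply: continuous_mul; first exact: continuous_cst.
  by apply: continuous_sum => i; apply: continuous_comp_iter; exact: (continuous_cohomologous cu gE).
apply: continuous_mul; first exact: continuous_cst.
have -> : (fun x => birkhoff g n x ^+ 2) = fun x => birkhoff g n x * birkhoff g n x.
  by apply/funext => x; rewrite expr2.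
exact: continuous_mul.
Qed.

Lemma bmeas_weight n : bmeas (gibbs_weight n).
Proof. by apply: bmeas_expR; apply: continuous_bmeas; exact: continuous_energy. Qed.

End birkhoff.

(** * Gibbs weights of cylinders *)

Section gibbs.
Context {R : realType}.
Variables (g u : Omega -> R) (A beta : R) (mu : probability Omega R).
Hypothesis cu : continuous u.
Hypothesis gE : forall x, g x = A * spin (x 0%N) + u (Omega_shift x) - u x.
Hypothesis beta0 : 0 < beta.
Hypothesis mu_max : maximal_entropy_probability mu.

Let weight := gibbs_weight g beta.
Let b := beta * A ^+ 2.

Let bw n : bmeas (weight n) := bmeas_weight cu gE beta n.

Definition cyl_mass n s : R := \int[mu]_x ((is_prefix s x)%:R * weight n x).

Let muE := maximal_entropy_bernoulli mu_max.

Lemma cyl_mass_split n s :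
  cyl_mass n s = cyl_mass n (rcons s true) + cyl_mass n (rcons s false).
Proof.
rewrite /cyl_mass -E_D; [|exact: bmeas_prefix_mul|exact: bmeas_prefix_mul].
apply: eq_Rintegral => x _; rewrite -mulrDl; congr (_ * _).
rewrite -!cats1 !is_prefix_cat /=.
by case: (is_prefix s x) (iter _ _ x 0%N) => -[]; rewrite /= ?addr0 ?add0r.
Qed.

Lemma cyl_mass_words n s N :
  cyl_mass n s = \sum_(z <- words N) cyl_mass n (s ++ z).
Proof.
rewrite /cyl_mass -E_sum; last by move=> z; exact: bmeas_prefix_mul.
apply: eq_Rintegral => x _.
have := sum_prefix N (iter (size s) Omega_shift x) (fun=> (is_prefix s x)%:R * weight n x).
move=> <-; apply: eq_bigr => z _; rewrite is_prefix_cat -mulnb natrM; ring.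
Qed.

Definition tail_integral (c : R) : R := \int[mu]_x expR (c * u x).

(** The average, over the coordinates beyond [n], of the part of the Gibbs weight
    which depends on the prefix [s], when the magnetization density of the
    intermediate coordinates is [v]. *)
Definition cyl_factor s (v : R) : R :=
  expR (beta * A * v * (A * magn s - u (concat s (fun=> true)))) *
  tail_integral (beta * A * v).

Lemma bmeas_cu c : bmeas (fun x => c * u x).
Proof. by apply: bmeasZ; exact: continuous_bmeas. Qed.

Lemma tail_integral_gt0 c : 0 < tail_integral c.
Proof. by apply: E_exp_gt0; exact: bmeas_cu. Qed.

Lemma cyl_factor_gt0 s v : 0 < cyl_factor s v.
Proof. by rewrite mulr_gt0 ?expR_gt0 ?tail_integral_gt0. Qed.

(** Since [u] is bounded, so is the derivative in [v] of the logarithm of the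
    integrand. *)
Lemma cyl_factor_close s : exists2 K, 0 <= K & forall v w,
  log_close (K * `|v - w|) (cyl_factor s w) (cyl_factor s v).
Proof.
have [M uM] := cyl_uniform_bounded (continuous_cyl_uniform cu).
have M0 : 0 <= M by apply: le_trans (uM (fun=> true)).
pose r := A * magn s - u (concat s (fun=> true)).
have cE v : cyl_factor s v = \int[mu]_x expR (beta * A * v * (r + u x)).
  rewrite /cyl_factor /tail_integral -E_Z; last exact/bmeas_expR/bmeas_cu.
  by apply: eq_Rintegral => x _; rewrite -expRD -mulrDr.
pose K := `|beta * A| * (`|r| + M); exists K; first by rewrite mulr_ge0// addr_ge0.
have bv v : bmeas (fun x => expR (beta * A * v * (r + u x))).
  apply: bmeas_expR; apply: bmeasZ; apply: bmeasD; first exact: bmeas_cst.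
  exact: continuous_bmeas.
move=> v w; rewrite /log_close !cE -!E_Z//.
have key x : `|beta * A * v * (r + u x) - beta * A * w * (r + u x)| <= K * `|v - w|.
  rewrite -mulrBl -mulrBr !normrM -mulrA [`|v - w| * _]mulrC mulrA.
  rewrite ler_wpM2r// /K normrM ler_wpM2l ?mulr_ge0//.
  by rewrite (le_trans (ler_normD _ _))// lerD2l.
apply/andP; split; apply: E_le => [||x]; try exact: bv; try (by apply: bmeasZ; exact: bv);
  by rewrite -expRD ler_expR; move: (key x); rewrite ler_norml => /andP[]; lra.
Qed.

Lemma continuous_cyl_factor s : continuous (cyl_factor s).
Proof.
have [K K0 H] := cyl_factor_close s; move=> v.
apply: (@squeeze_cvgr _ _ _ _ (fun w => expR (- (K * `|w - v|)) * cyl_factor s v)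
  (fun w => expR (K * `|w - v|) * cyl_factor s v)).
- by apply: nearW => w; exact: H.
- have E : expR (- (K * `|v - v|)) * cyl_factor s v = cyl_factor s v.
    by rewrite subrr normr0 mulr0 oppr0 expR0 mul1r.
  rewrite -[X in _ --> X]E.
  apply: cvgM; last exact: cvg_cst.
  apply: (@cvg_comp _ _ _ (fun w => - (K * `|w - v|)) expR); last exact: continuous_expR.
  apply: cvgN; apply: cvgM; first exact: cvg_cst.
  by apply: cvg_norm; apply: cvgB; [exact: cvg_id | exact: cvg_cst].
- have E : expR (K * `|v - v|) * cyl_factor s v = cyl_factor s v.
    by rewrite subrr normr0 mulr0 expR0 mul1r.
  rewrite -[X in _ --> X]E.
  apply: cvgM; last exact: cvg_cst.
  apply: (@cvg_comp _ _ _ (fun w => K * `|w - v|) expR); last exact: continuous_expR.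
  apply: cvgM; first exact: cvg_cst.
  by apply: cvg_norm; apply: cvgB; [exact: cvg_id | exact: cvg_cst].
Qed.

Lemma cyl_factor_bounded s : exists D, forall v, `|v| <= 1 -> `|cyl_factor s v| <= D.
Proof.
have [K K0 H] := cyl_factor_close s.
exists (expR K * cyl_factor s 0) => v v1.
rewrite gtr0_norm ?cyl_factor_gt0//.
have /andP[_ le2] := H v 0; apply: (le_trans le2).
apply: ler_wpM2r; first exact/ltW/cyl_factor_gt0.
by rewrite ler_expR subr0 ler_piMr.
Qed.

Section level.
Variables (k : nat) (e M : R).
Hypotheses (uM : forall x, `|u x| <= M) (ue : forall x z, agree k x z -> `|u x - u z| <= e).

Let c := `|beta * A|.
Let K := `|A| * k%:R + M + M.

(** With [S_n = n A v + r], the square [S_n^2 / n] is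
    [n A^2 v^2 + 2 A v r + r^2 / n]. Here [r] is bounded by [K], and replacing [u x]
    by the value of [u] at one point of the cylinder of [s] changes [r] by at most
    [e]. *)
Lemma weight_close s z x : size s = k -> let n := (k + size z)%N in (0 < n)%N ->
  let v := magn z / n%:R in is_prefix (s ++ z) x ->
  log_close (c * e + beta * K ^+ 2 / 2 / n%:R)
    (expR (b * n%:R / 2 * v ^+ 2) *
     expR (beta * A * v * (A * magn s - u (concat s (fun=> true)) + u (iter n Omega_shift x))))
    (weight n x).
Proof.
move=> sk n n0 v xs.
have sz : size (s ++ z) = n by rewrite size_cat sk.
have SE := birkhoff_sum_prefix gE xs; rewrite sz magn_cat in SE.
have nn : 0 < n%:R :> R by rewrite ltr0n.
set us := u (concat s _); set ut := u (iter n _ x).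
rewrite -/ut in SE.
pose r := A * magn s + ut - u x.
have rK : `|r| <= K.
  rewrite (le_trans (ler_normB _ _))// lerD ?uM// (le_trans (ler_normD _ _))// lerD ?uM//.
  by rewrite normrM ler_wpM2l// -sk magn_norm.
have us_e : `|us - u x| <= e.
  apply: ue; apply: agree_sym; rewrite -sk; apply/(is_prefixP s x (fun=> true)).
  by move: xs; rewrite is_prefix_cat => /andP[].
have WE : beta * n%:R / 2 * birkhoff g n x ^+ 2 =
    b * n%:R / 2 * v ^+ 2 + beta * A * v * r + beta / 2 / n%:R * r ^+ 2.
  rewrite /birkhoff SE /b /v /r.
  by move: (gt_eqF nn); move: n%:R => n' /negbT n'0; field.
have v1 : `|v| <= 1.
  rewrite /v normrM normfV [`|n%:R|]gtr0_norm// ler_pdivrMr// mul1r.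
  by rewrite (le_trans (magn_norm z))// ler_nat leq_addl.
have q0 : 0 <= beta / 2 / n%:R by rewrite !divr_ge0 ?ltW.
have r2 : beta / 2 / n%:R * r ^+ 2 <= beta * K ^+ 2 / 2 / n%:R.
  rewrite (_ : beta * K ^+ 2 / 2 / n%:R = beta / 2 / n%:R * K ^+ 2); last by ring.
  apply: ler_wpM2l => //; rewrite -[leLHS]real_normK ?num_real//.
  by apply: lerXn2r; rewrite ?nnegrE// (le_trans _ rK).
have r2' : 0 <= beta / 2 / n%:R * r ^+ 2 by rewrite mulr_ge0// sqr_ge0.
have d1 : `|beta * A * v * (us - u x)| <= c * e.
  rewrite -mulrA normrM ler_wpM2l// normrM (le_trans _ us_e)//.
  by rewrite ler_piMl.
rewrite /log_close -!expRD !ler_expR WE.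
have -> : beta * A * v * r =
    beta * A * v * (A * magn s - us + ut) + beta * A * v * (us - u x).
  by rewrite /r; ring.
by move: d1; rewrite ler_norml => /andP[]; lra.
Qed.

(** Sum [weight_close] over the words [z] that follow [s]; given [s ++ z] the tail
    [T^n x] is independent and distributed as [mu]. *)
Lemma cyl_mass_close s N : size s = k -> (0 < k + N)%N ->
  log_close (c * e + beta * K ^+ 2 / 2 / (k + N)%:R)
    (2^-1 ^+ (k + N) * cw_sum b k (cyl_factor s) N) (cyl_mass (k + N) s).
Proof.
move=> sk n0; rewrite (cyl_mass_words _ _ N) /cw_sum mulr_sumr.
rewrite /log_close !mulr_sumr big_seq [X in _ <= X <= _]big_seq [X in _ <= _ <= X]big_seq.
suff H z : z \in words N -> log_close (c * e + beta * K ^+ 2 / 2 / (k + N)%:R)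
    (2^-1 ^+ (k + N) * (expR (b * (k + N)%:R / 2 * (magn z / (k + N)%:R) ^+ 2) *
       cyl_factor s (magn z / (k + N)%:R))) (cyl_mass (k + N) (s ++ z)).
  by apply/andP; split; apply: ler_sum => z /H /andP[].
move=> /size_words zN; set v := magn z / _; set w := _ + beta * _ / _ / _.
pose r := A * magn s - u (concat s (fun=> true)).
pose F x := expR (beta * A * v * (r + u x)).
have cF : continuous F.
  apply: continuous_exp; apply: continuous_mul; first exact: continuous_cst.
  by apply: continuous_add => //; exact: continuous_cst.
have sz : size (s ++ z) = (k + N)%N by rewrite size_cat sk zN.
have FE : \int[mu]_x ((is_prefix (s ++ z) x)%:R * F (iter (k + N) Omega_shift x)) =
    2^-1 ^+ (k + N) * cyl_factor s v.
  rewrite -sz (bernoulli_independence muE _ cF) sz; congr (_ * _).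
    by rewrite word_weightE mul0r expR0 mul1r sz /cosh oppr0 expR0 exprVn; congr (_ ^- _); field.
  rewrite /cyl_factor /tail_integral -E_Z; last exact/bmeas_expR/bmeas_cu.
  by apply: eq_Rintegral => x _; rewrite -expRD -mulrDr.
have bF0 : bmeas (fun x => (is_prefix (s ++ z) x)%:R * F (iter (k + N) Omega_shift x)).
  by apply: bmeas_prefix_mul; apply: bmeas_iter; exact: continuous_bmeas.
rewrite mulrCA -FE /log_close -!E_Z; do ?[exact: bF0 | exact: (bmeasZ _ bF0)].
have bF e1 e2 : bmeas (fun x => e1 * (e2 * ((is_prefix (s ++ z) x)%:R * F (iter (k + N) Omega_shift x)))).
  by do 2 apply: bmeasZ.
have bI : bmeas (fun x => (is_prefix (s ++ z) x)%:R * weight (k + N) x).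
  exact: bmeas_prefix_mul.
have pw x : log_close w (expR (b * (k + N)%:R / 2 * v ^+ 2) *
     ((is_prefix (s ++ z) x)%:R * F (iter (k + N) Omega_shift x)))
     ((is_prefix (s ++ z) x)%:R * weight (k + N) x).
  case: (boolP (is_prefix (s ++ z) x)) => xs; last by rewrite !mul0r mulr0 /log_close !mulr0 lexx.
  rewrite !mul1r; have := @weight_close s z x sk; rewrite /= zN => /(_ n0 xs).
  exact.
by apply/andP; split; apply: E_le => // x; case/andP: (pw x).
Qed.

End level.
End gibbs.

(** * Asymptotics of the Gibbs weights *)

Section concentration.
Context {R : realType}.
Variables (g u : Omega -> R) (A beta : R) (mu : probability Omega R).
Hypothesis cu : continuous u.
Hypothesis gE : forall x, g x = A * spin (x 0%N) + u (Omega_shift x) - u x.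
Hypothesis beta0 : 0 < beta.
Hypothesis mu_max : maximal_entropy_probability mu.
Hypothesis A0 : A != 0.

Let b := beta * A ^+ 2.

Let b0 : 0 < b.
Proof. by rewrite mulr_gt0// exprn_even_gt0. Qed.

Let mass := cyl_mass g beta mu.
Let factor := cyl_factor u A beta mu.

(** A common scale for the masses of all cylinders of length [k]. *)
Definition normalizer (k n : nat) : R := 2^-1 ^+ n * cw_sum b k (fun=> 1) (n - k).

Lemma normalizer_gt0 k n : 0 < normalizer k n.
Proof.
by apply: mulr_gt0; [rewrite exprn_gt0// invr_gt0 | exact: cw_sum_gt0].
Qed.

Section near_level.
Variables (m : R).
Hypotheses (m0 : m != 0) (mE : tanh (b * m) = m).

Variables (k : nat) (e : R).
Hypothesis ue : forall x z, agree k x z -> `|u x - u z| <= e.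

(** The density of the coordinates after [s] concentrates at [m] and [- m]. *)
Lemma cyl_mass_near s eta : size s = k -> 0 < eta ->
  \forall n \near \oo, log_close (`|beta * A| * e + eta)
    ((factor s m + factor s (- m)) / 2) (mass n s / normalizer k n).
Proof.
move=> sk eta0.
have [M uM] := cyl_uniform_bounded (continuous_cyl_uniform cu).
have e0 : 0 <= e by apply: le_trans (ue (x := fun=> true) (z := fun=> true) _).
set L := _ / 2.
have L0 : 0 < L by rewrite divr_gt0// addr_gt0 ?cyl_factor_gt0.
have eta2 : 0 < eta / 2 by rewrite divr_gt0.
pose K := `|A| * k%:R + M + M.
have cwl := curie_weiss_limit k b0 m0 mE (@continuous_cyl_factor R u A beta mu cu s)
  (cyl_factor_bounded A beta mu cu s).
have d0 : 0 < L * (1 - expR (- (eta / 2))).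
  by rewrite mulr_gt0// subr_gt0 expR_lt1 oppr_lt0.
move: cwl => /cvgrPdist_le/(_ _ d0)[N0 _ HN0].
have [N1 _ HN1] : \forall n \near \oo, beta * K ^+ 2 / 2 / (eta / 2) <= n%:R.
  exact: nbhs_infty_ger.
exists (N0 + N1 + k).+1 => // n /= nN.
have nk : (k + (n - k))%N = n by rewrite subnKC// ltnW// (leq_ltn_trans _ nN)// leq_addl.
have Z0 := normalizer_gt0 k n.
pose J := cw_sum b k (factor s) (n - k) / cw_sum b k (fun=> 1) (n - k).
have LJ : log_close (eta / 2) L J.
  have := HN0 (n - k)%N; rewrite /= leq_subRL; last first.
    by rewrite (leq_trans _ (ltnW nN))// leq_addl.
  have le1 : (k + N0 <= n)%N by rewrite (leq_trans _ (ltnW nN))// addnC leq_add2r leq_addr.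
  move=> /(_ le1); rewrite -/J -/L.
  rewrite ler_norml => /andP[]; set E := expR _ => h1 h2.
  have E1 : E * expR (eta / 2) = 1 by rewrite -expRD addNr expR0.
  have Ep : 0 < E := expR_gt0 _; have Fp : 0 < expR (eta / 2) := expR_gt0 _.
  rewrite /log_close -/E; apply/andP; split; first by lra.
  have h3 : 2 - E <= expR (eta / 2).
    have := mulr_ge0 (ltW Ep) (sqr_ge0 (expR (eta / 2) - 1)).
    move: E1; set F := expR _ => E1.
    rewrite (_ : E * _ = E * F * F - 2 * (E * F) + E); last by ring.
    by rewrite E1; lra.
  apply: (@le_trans _ _ (L * (2 - E))); first by lra.
  by rewrite mulrC ler_pM2r.
have err : beta * K ^+ 2 / 2 / n%:R <= eta / 2.
  have n0 : 0 < n%:R :> R by rewrite ltr0n (leq_ltn_trans _ nN).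
  have := HN1 n; rewrite /= => /(_ (leq_trans (leq_trans (leq_addl _ _) (leq_addr _ _)) (ltnW nN))).
  by rewrite ler_pdivrMr// => H; rewrite ler_pdivrMr// [leRHS]mulrC.
have n0 : (0 < k + (n - k))%N by rewrite nk (leq_ltn_trans _ nN).
have := cyl_mass_close cu gE beta0 mu_max uM ue sk n0; rewrite nk => H.
have Zi : 0 <= (normalizer k n)^-1 by rewrite invr_ge0 ltW.
have := log_close_mul Zi H.
rewrite (_ : _^-1 * (_ * _) = J); last first.
  rewrite /J /normalizer invfM mulrACA mulVf; first by rewrite mul1r mulrC.
  by rewrite expf_neq0// invr_neq0.
rewrite -/mass [_^-1 * _]mulrC => H'.
apply: log_close_le (log_close_trans LJ H'); first exact: ltW.
by rewrite -/K; lra.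
Qed.

End near_level.

Section target.
Variables (t lambda : R) (h : Omega -> R) (nu : probability Omega R).
Hypothesis D : ruelle_eigendata (tilted_potential (fun=> - ln 2) g beta t) lambda h nu.

(** Write [h = K exp (beta t u)]. Then [mu (h)] is [K] times a tail integral, and by
    [eigendata_cyl] the mass of the cylinder under [nu] is its Bernoulli weight
    divided by [K exp (beta t u)]: up to the same error, the
    product is [cyl_factor] at density [t / A], divided by a power of [2 cosh y] that
    depends only on the length. *)
Lemma eigendata_factor k e s :
  (forall x z, agree k x z -> `|u x - u z| <= e) -> size s = k ->
  log_close (`|beta * t| * e) (factor s (t / A) / (2 * cosh (beta * t * A)) ^+ k)
    ((\int[mu]_x h x) * fine (nu (cyl s))).
Proof.
move=> ue sk; have [K K0 hE] := eigenfunctionE cu gE D.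
rewrite -sk in ue.
have := eigendata_cyl cu gE D hE K0 ue.
rewrite -/(log_close (`|beta * t| * e) (word_weight (beta * t * A) s) _).
set z := concat s _ => H.
have -> : \int[mu]_x h x = K * tail_integral u mu (beta * t).
  rewrite /tail_integral -E_Z; last exact/bmeas_expR/bmeas_cu.
  by apply: eq_Rintegral => x _; rewrite hE.
have W0 := tail_integral_gt0 mu cu (beta * t).
set W := tail_integral _ _ _ in W0 *.
have c0 : 0 <= W * expR (- (beta * t * u z)) by rewrite mulr_ge0 ?ltW ?expR_gt0.
have := log_close_mul c0 H; congr log_close.
  rewrite word_weightE sk /factor /cyl_factor -/z.
  have -> : beta * A * (t / A) = beta * t by field.
  rewrite -/W.
  have -> : beta * t * (A * magn s - u z) = - (beta * t * u z) + beta * t * A * magn s by ring.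
  by rewrite expRD; ring.
rewrite expRN; field.
by rewrite gt_eqF ?expR_gt0.
Qed.

End target.
End concentration.

Section mixture.
Context {R : realType}.
Variables (nu1 nu2 : probability Omega R) (p1 p2 : {nonneg R}).
Hypothesis p12 : p1%:num + p2%:num = 1.

Definition mixture of p1%:num + p2%:num = 1 : set Omega -> \bar R :=
  measure_add (mscale p1 nu1) (mscale p2 nu2).

HB.instance Definition _ := Measure.on (mixture p12).

Let mixtureT : mixture p12 [set: Omega] = 1%:E.
Proof.
rewrite /mixture measure_addE /= /mscale.
have /= -> := probability_setT nu1; have /= -> := probability_setT nu2.
by rewrite !mule1 -EFinD p12.
Qed.

HB.instance Definition _ := @Measure_isProbability.Build _ _ R (mixture p12) mixtureT.

Lemma mixture_probability : exists P : probability Omega R, forall B, measurable B ->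
  P B = (p1%:num * fine (nu1 B) + p2%:num * fine (nu2 B))%:E.
Proof.
exists (mixture p12 : probability Omega R) => B mB.
by rewrite /= /mixture measure_addE /mscale EFinD !EFinM !probability_fineK.
Qed.

End mixture.

Section limit.
Context {R : realType}.
Variables (g u : Omega -> R) (A beta : R) (mu : probability Omega R).
Hypothesis cu : continuous u.
Hypothesis gE : forall x, g x = A * spin (x 0%N) + u (Omega_shift x) - u x.
Let weight := gibbs_weight g beta.
Let mass := cyl_mass g beta mu.

Let bw n : bmeas (weight n) := bmeas_weight cu gE beta n.

Lemma E_weight_gt0 n : 0 < \int[mu]_x weight n x.
Proof.
have bf : bmeas (fun x => beta * n%:R / 2 * birkhoff g n x ^+ 2).
  by apply: continuous_bmeas; exact: (continuous_energy cu gE).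
exact: (E_exp_gt0 mu bf).
Qed.

(** Approximate the test function uniformly by functions of finitely many
    coordinates; both sides are averages. *)
Lemma cvg_of_cylinders (P : probability Omega R) :
  (forall s, (fun n => mass n s / \int[mu]_x weight n x) @ \oo --> fine (P (cyl s))) ->
  quadratic_mean_field_gibbs mu beta g P.
Proof.
move=> H w psi cpsi; rewrite {}/w.
change ((fun n : nat => (\int[mu]_x (psi x * weight n x)) / \int[mu]_x weight n x)
  @ \oo --> \int[P]_x psi x).
apply/cvgrPdist_le => e e0.
have bpsi := continuous_bmeas cpsi.
have e4 : 0 < e / 3 by rewrite divr_gt0.
have [k Hk] := cyl_approxP cpsi e4.
have ba := bmeas_cyl_approx k psi.
have step : (fun n => (\int[mu]_x (cyl_approx k psi x * weight n x)) / \int[mu]_x weight n x) @ \oo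
   --> \int[P]_x cyl_approx k psi x.
  rewrite E_cyl_approx.
  have -> : (fun n => (\int[mu]_x (cyl_approx k psi x * weight n x)) / \int[mu]_x weight n x) =
    (fun n => \sum_(s <- words k) psi (concat s (fun=> true)) * (mass n s / \int[mu]_x weight n x)).
    apply/funext => n; under [RHS]eq_bigr do rewrite mulrA.
    rewrite -mulr_suml; congr (_ / _); rewrite [RHS](eq_bigr (fun s => \int[mu]_x (psi (concat s (fun=> true)) * ((is_prefix s x)%:R * weight n x)))); last first.
      by move=> s _; rewrite E_Z//; exact: bmeas_prefix_mul.
    rewrite -E_sum; last by move=> s; apply: bmeasZ; exact: bmeas_prefix_mul.
    apply: eq_Rintegral => x _; rewrite /cyl_approx mulr_suml.
    by apply: eq_bigr => s _; rewrite mulrA.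
  elim: (words k) => [|s l IH].
    under eq_fun do rewrite big_nil; rewrite big_nil; exact: cvg_cst.
  under eq_fun do rewrite big_cons; rewrite big_cons; apply: cvgD => //.
  by apply: cvgM; [exact: cvg_cst | exact: H].
move: step => /cvgrPdist_le/(_ _ e4); apply: filterS => n Hn.
have W0 := E_weight_gt0 n.
have h1 : `|\int[P]_x psi x - \int[P]_x cyl_approx k psi x| <= e / 3 by exact: E_dist.
have h2 : `|(\int[mu]_x (cyl_approx k psi x * weight n x)) / \int[mu]_x weight n x -
   (\int[mu]_x (psi x * weight n x)) / \int[mu]_x weight n x| <= e / 3.
  rewrite -mulrBl normrM normfV [`|Rintegral _ _ (weight n)|]gtr0_norm// ler_pdivrMr//.
  rewrite -(E_Z mu (e / 3) (bw n)) -(E_B mu (bmeasM ba (bw n)) (bmeasM bpsi (bw n))).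
  have wge x : 0 < weight n x by exact: expR_gt0.
  have key x : `|cyl_approx k psi x * weight n x - psi x * weight n x| <= e / 3 * weight n x.
    by rewrite -mulrBl normrM (gtr0_norm (wge x)) ler_pM2r// distrC.
  have bd : bmeas (fun x => cyl_approx k psi x * weight n x - psi x * weight n x).
    by apply: bmeasB; exact: bmeasM.
  rewrite ler_norml; apply/andP; split.
    rewrite -[X in X <= _]mulN1r -E_Z; last exact: bmeasZ.
    apply: E_le => // [|x]; first by do 2 apply: bmeasZ.
    by rewrite mulN1r; move: (key x); rewrite ler_norml => /andP[].
  apply: E_le => // [|x]; first exact: bmeasZ.
  by move: (key x); rewrite ler_norml => /andP[].
set X := _ / \int[mu]_x _ in h2 Hn; set Y := _ / \int[mu]_x _ in h2 *.
rewrite (_ : e = e / 3 + (e / 3 + e / 3)); last by field.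
rewrite -(subrKA (\int[P]_x cyl_approx k psi x)) (le_trans (ler_normD _ _))// lerD//.
by rewrite -(subrKA X) (le_trans (ler_normD _ _))// lerD.
Qed.

End limit.

(** * The mean-field Gibbs probability *)

Section two_phases.
Context {R : realType}.
Variables (g u : Omega -> R) (A beta t : R) (mu : probability Omega R).
Hypothesis cu : continuous u.
Hypothesis gE : forall x, g x = A * spin (x 0%N) + u (Omega_shift x) - u x.
Hypothesis beta0 : 0 < beta.
Hypothesis mu_max : maximal_entropy_probability mu.
Hypothesis A0 : A != 0.
Hypothesis t0 : t != 0.
Hypothesis tE : tanh (beta * t * A) = t / A.
Variables (lambda1 lambda2 : R) (h1 h2 : Omega -> R) (nu1 nu2 : probability Omega R).
Hypothesis D1 : ruelle_eigendata (tilted_potential (fun=> - ln 2) g beta t) lambda1 h1 nu1.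
Hypothesis D2 : ruelle_eigendata (tilted_potential (fun=> - ln 2) g beta (- t)) lambda2 h2 nu2.

Let mass := cyl_mass g beta mu.
Let factor := cyl_factor u A beta mu.
Let Z := normalizer A beta.
Let M1 := \int[mu]_x h1 x.
Let M2 := \int[mu]_x h2 x.

Let m := t / A.
Let m0 : m != 0. Proof. by rewrite mulf_neq0// invr_neq0. Qed.
Let mE : tanh (beta * A ^+ 2 * m) = m.
Proof. by rewrite -[RHS]tE; congr tanh; rewrite /m; field. Qed.

Lemma E_eigenfunction_gt0 s (lambda : R) (h : Omega -> R) (nu : probability Omega R) :
  ruelle_eigendata (tilted_potential (fun=> - ln 2) g beta s) lambda h nu ->
  0 < \int[mu]_x h x.
Proof.
move=> D; have [K K0 hE] := eigenfunctionE cu gE D.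
under eq_Rintegral do rewrite hE.
have bf := bmeas_cu cu (beta * s).
by rewrite (E_Z mu K (bmeas_expR bf)) mulr_gt0// E_exp_gt0.
Qed.

Let M10 : 0 < M1 := E_eigenfunction_gt0 D1.
Let M20 : 0 < M2 := E_eigenfunction_gt0 D2.

Definition phase_mass s : R := M1 * fine (nu1 (cyl s)) + M2 * fine (nu2 (cyl s)).

Lemma cyl_split (nu : probability Omega R) s :
  fine (nu (cyl s)) = fine (nu (cyl (rcons s true))) + fine (nu (cyl (rcons s false))).
Proof.
rewrite -!E_prefix -E_D; [|exact: bmeas_prefix|exact: bmeas_prefix].
apply: eq_Rintegral => x _; rewrite -!cats1 !is_prefix_cat /=.
by case: (is_prefix s x) (iter _ _ x 0%N) => -[]; rewrite /= ?addr0 ?add0r.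
Qed.

Lemma phase_mass_ge0 s : 0 <= phase_mass s.
Proof.
by rewrite addr_ge0// mulr_ge0 ?(ltW M10) ?(ltW M20)// fine_ge0.
Qed.

Lemma phase_mass_nil : phase_mass [::] = M1 + M2.
Proof.
have E (nu : probability Omega R) : fine (nu (cyl [::])) = 1.
  rewrite (_ : cyl [::] = setT); last by apply/seteqP; split.
  by have /= -> := probability_setT nu.
by rewrite /phase_mass !E !mulr1.
Qed.

Section level.
Variables (k : nat) (e eta : R).
Hypothesis ue : forall x z, agree k x z -> `|u x - u z| <= e.
Hypothesis eta0 : 0 < eta.

Let kappa : R := (2 * cosh (beta * t * A)) ^+ k / 2.
Let w : R := `|beta * t| * e + (`|beta * A| * e + eta).

Let kappa0 : 0 < kappa.
Proof. by rewrite divr_gt0// exprn_gt0// mulr_gt0// cosh_gt0. Qed.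

(** The normalizer only compares cylinders of length [k]. A shorter word is the sum
    of its two extensions, whence the induction on the missing length [i]. *)
Lemma cyl_mass_phase i s : (size s + i)%N = k ->
  \forall n \near \oo, log_close w (kappa * phase_mass s) (mass n s / Z k n).
Proof.
elim: i s => [|i IH] s si; last first.
  have st : (size (rcons s true) + i)%N = k by rewrite size_rcons addSnnS.
  have sf : (size (rcons s false) + i)%N = k by rewrite size_rcons addSnnS.
  apply: filterS2 (IH _ st) (IH _ sf) => n Ht Hf.
  have := log_close_add Ht Hf; rewrite -mulrDl -mulrDr /mass.
  rewrite -(@cyl_mass_split R g u A beta mu cu gE); congr log_close; congr (_ * _).
  by rewrite /phase_mass 2!(cyl_split _ s); ring.
have sk : size s = k by rewrite -si addn0.
apply: filterS (cyl_mass_near cu gE beta0 mu_max A0 m0 mE ue sk eta0) => n H.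
apply: log_close_trans H.
have c1 := eigendata_factor mu cu gE A0 D1 ue sk.
have c2 := eigendata_factor mu cu gE A0 D2 ue sk.
rewrite mulrN !mulNr coshN normrN in c2.
apply: log_close_sym; have := log_close_mul (ltW kappa0) (log_close_add c1 c2).
congr log_close; rewrite /kappa /factor /m -mulrDl.
have q0 : (2 * cosh (beta * t * A)) ^+ k != 0.
  by rewrite expf_neq0// mulf_neq0// gt_eqF// cosh_gt0.
by move: q0; move: (_ ^+ k) => q q0; field.
Qed.

End level.

(** Compare [s] and the empty word at a level [k] where [u] oscillates little: the
    normalizer and the constant of [cyl_mass_phase] cancel in the quotient. *)
Lemma cyl_ratio_cvg s :
  (fun n => mass n s / \int[mu]_x gibbs_weight g beta n x) @ \oo -->
  phase_mass s / (M1 + M2).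
Proof.
have M0 : 0 < M1 + M2 by rewrite addr_gt0.
apply: log_close_cvg; first by rewrite divr_ge0 ?phase_mass_ge0// ltW.
move=> w w0.
pose C := `|beta * t| + `|beta * A| + 1.
have C0 : 0 < C by rewrite ltr_wpDl// addr_ge0.
have e0 : 0 < w / 4 / C by rewrite !divr_gt0.
have eta0 : 0 < w / 4 by rewrite divr_gt0.
have [k0 Hk0] := continuous_cyl_uniform cu e0.
pose k := (size s + k0)%N.
have ue x z : agree k x z -> `|u x - u z| <= w / 4 / C.
  by move=> xz; apply: Hk0; apply: agree_le xz; exact: leq_addl.
have H1 := cyl_mass_phase ue eta0 (i := k0) (s := s) erefl.
have H2 := cyl_mass_phase ue eta0 (i := k) (s := [::]) erefl.
apply: filterS2 H1 H2 => n h1' h2'.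
have Z0 : 0 < Z k n by apply: normalizer_gt0.
have massE : mass n [::] = \int[mu]_x gibbs_weight g beta n x.
  by apply: eq_Rintegral => x _; rewrite mul1r.
have W0 := E_weight_gt0 beta mu cu gE n.
set kap := _ ^+ k / 2 in h1' h2'.
have kap0 : 0 < kap by rewrite divr_gt0// exprn_gt0// mulr_gt0// cosh_gt0.
rewrite massE phase_mass_nil in h2'.
have := log_close_div _ _ _ h1' h2'.
rewrite mulr_ge0 ?phase_mass_ge0 ?ltW// mulr_gt0// divr_gt0//.
move=> /(_ isT isT isT).
have -> : kap * phase_mass s / (kap * (M1 + M2)) = phase_mass s / (M1 + M2).
  by field; rewrite !gt_eqF.
have -> : mass n s / Z k n / ((\int[mu]_x gibbs_weight g beta n x) / Z k n) =
    mass n s / \int[mu]_x gibbs_weight g beta n x.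
  by field; rewrite !gt_eqF.
apply: log_close_le; first by rewrite divr_ge0 ?phase_mass_ge0// ltW.
have : (C - 1) * (w / 4 / C) <= w / 4.
  by rewrite mulrA ler_pdivrMr// mulrC ler_pM2l// gerBl.
by rewrite /C; lra.
Qed.

Lemma mean_field_gibbs_phases :
  (exists P : probability Omega R, quadratic_mean_field_gibbs mu beta g P) /\
  (forall P : probability Omega R, quadratic_mean_field_gibbs mu beta g P ->
     forall B : set Omega, measurable B ->
       P B = ((M1 * fine (nu1 B) + M2 * fine (nu2 B)) / (M1 + M2))%:E).
Proof.
have M0 : 0 < M1 + M2 by rewrite addr_gt0.
have p1 : 0 <= M1 / (M1 + M2) by rewrite divr_ge0 ?ltW.
have p2 : 0 <= M2 / (M1 + M2) by rewrite divr_ge0 ?ltW.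
have p12 : (NngNum p1)%:num + (NngNum p2)%:num = 1 :> R.
  by rewrite /= -mulrDl mulfV// gt_eqF.
have [Q QE] := mixture_probability nu1 nu2 p12.
have {}QE B : measurable B -> Q B = ((M1 * fine (nu1 B) + M2 * fine (nu2 B)) / (M1 + M2))%:E.
  by move=> mB; rewrite QE//=; congr (_%:E); ring.
have Qcyl s : fine (Q (cyl s)) = phase_mass s / (M1 + M2).
  by rewrite QE; last exact: measurable_cyl.
split.
  exists Q; apply: (cvg_of_cylinders cu gE) => s; rewrite Qcyl; exact: cyl_ratio_cvg.
move=> P HP B mB; rewrite -QE//.
have finP : (P [set: Omega] < +oo)%E.
  by have /= -> := probability_setT P; rewrite ltry.
apply: (measure_cyl_unique finP _ mB) => s.
have mc := measurable_cyl s.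
suff E : fine (P (cyl s)) = fine (Q (cyl s)).
  by have := congr1 EFin E; rewrite !probability_fineK.
rewrite Qcyl -E_prefix.
have cp := HP _ (@continuous_prefix R s).
have cr := @cyl_ratio_cvg s.
rewrite -(cvg_lim (@Rhausdorff R) cp); exact: (cvg_lim (@Rhausdorff R) cr).
Qed.

End two_phases.

Theorem theorem2p14 (R : realType) (a : nat -> R) (beta t1 t2 : R)
    (mu : probability Omega R)
    (lambda1 lambda2 : R) (h1 h2 : Omega -> R) (nu1 nu2 : probability Omega R) :
  let g := linear_potential a in
  let f := (fun _ : Omega => - ln (2 : R)) in
  exponentially_to_zero a ->
  (exists x : Omega, g x <> 0) ->
  0 < beta ->
  maximal_entropy_probability mu ->
  t1 <> 0 ->
  t2 = - t1 ->
  self_consistent f g beta t1 ->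
  self_consistent f g beta t2 ->
  ruelle_eigendata (tilted_potential f g beta t1) lambda1 h1 nu1 ->
  ruelle_eigendata (tilted_potential f g beta t2) lambda2 h2 nu2 ->
  (exists m : probability Omega R, quadratic_mean_field_gibbs mu beta g m) /\
  (forall m : probability Omega R, quadratic_mean_field_gibbs mu beta g m ->
     forall A : set Omega, measurable A ->
       m A = (((\int[mu]_x h1 x) * fine (nu1 A)
               + (\int[mu]_x h2 x) * fine (nu2 A))
              / ((\int[mu]_x h1 x) + (\int[mu]_x h2 x)))%:E).
Proof.
move=> g f ea _ beta0 mu_max t10 t2E sc1 _ D1 D2.
have [A [u [cu gE]]] := linear_potential_cohomology ea.
have /= tE := self_consistent_tanh cu gE D1 sc1.
have S0 : 0 < expR (beta * t1 * A) + expR (- (beta * t1 * A)) by rewrite addr_gt0 ?expR_gt0.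
have A0 : A != 0.
  apply/eqP => A0; move/eqP: tE.
  by rewrite [X in _ == X * _]A0 mul0r mulf_eq0 (gt_eqF S0) orbF => /eqP.
rewrite t2E in D2.
apply: (mean_field_gibbs_phases cu gE beta0 mu_max A0 _ _ D1 D2); first exact/eqP.
apply: (mulIf A0); rewrite divfK// /tanh /sinh /cosh.
apply: (mulIf (lt0r_neq0 S0)); rewrite [RHS]tE /=; field.
exact: lt0r_neq0.
Qed.
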